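(* Let $X$ be an infinite-dimensional Banach space. Then the set of all weak$^*$ continuous functions $f:[0,1]\to X^*$ which are not Riemann integrable is spaceable in $\ell_\infty([0,1],X^* )$.
   Context: All Banach spaces are real. $\ell_\infty([0,1],X^* )$ is the Banach space of all bounded functions from $[0,1]$ to $X^*$ with the supremum norm. A subset $M$ of a Banach space is spaceable if $M\cup\{0\}$ contains a closed infinite-dimensional linear subspace. A tagged partition of $[0,1]$ is a finite collection $\mathcal P=\{(s_i,[t_{i-1},t_i]):1\le i\le N\}$, where the $[t_{i-1},t_i]$ are non-overlapping closed intervals covering $[0,1]$ and $s_i\in(t_{i-1},t_i)$; its norm is $\max_i(t_i-t_{i-1})$, and for a function $f$ from $[0,1]$ into a Banach space $Z$ one puts $f(\mathcal P)=\sum_{i=1}^N (t_i-t_{i-1})f(s_i)$. Such an $f$ is Riemann integrable, with integral $z\in Z$, if for every $\varepsilon>0$ there is $\delta>0$ such that $\|f(\mathcal P)-z\|<\varepsilon$ for all tagged partitions $\mathcal P$ of $[0,1]$ with norm less than $\delta$ (here $Z=X^*$ with its dual norm). *)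

(* Defs.v *)
From HB Require Import structures.
From mathcomp Require Import all_boot all_order all_algebra.
From mathcomp Require Import all_classical all_reals all_analysis.
Import Order.TTheory GRing.Theory Num.Theory.
Import numFieldNormedType.Exports.

Set Implicit Arguments.
Unset Strict Implicit.
Unset Printing Implicit Defensive.

Local Open Scope classical_set_scope.
Local Open Scope ring_scope.

Section sup_norm.
Context {R : realType} {T : Type} {V : normedModType R}.
Implicit Types (A : set T) (f g : T -> V).

(* sup set0 = 0, so sup_norm A f = 0 when A is empty. *)
Definition sup_norm A f : R := sup [set `|f t| | t in A].

Lemma bounded_inP A f :
  [bounded f t | t in A] <-> exists M : R, forall t, A t -> `|f t| <= M.
Proof.
split=> [/pinfty_ex_gt0[M _ fM]|[M fM]]; first by exists M.
exists M; split; first exact: num_real.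
by move=> N MN t At; rewrite /= (le_trans (fM t At))// ltW.
Qed.

Lemma bounded_inD A f g : [bounded f t | t in A] -> [bounded g t | t in A] ->
  [bounded (f + g) t | t in A].
Proof.
move=> /bounded_inP[M fM] /bounded_inP[N gN]; apply/bounded_inP; exists (M + N).
by move=> t At; rewrite (le_trans (ler_normD _ _))// lerD ?fM ?gN.
Qed.

Lemma bounded_inZ A (a : R) f : [bounded f t | t in A] ->
  [bounded (a *: f) t | t in A].
Proof.
move=> /bounded_inP[M fM]; apply/bounded_inP; exists (`|a| * M).
by move=> t At; rewrite normrZ ler_wpM2l ?fM.
Qed.

Lemma le_sup_norm A f t : [bounded f t | t in A] -> A t ->
  `|f t| <= sup_norm A f.
Proof.
move=> /bounded_inP[M fM] At; apply: ub_le_sup; last by exists t.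
by exists M => _ [s As <-]; exact: fM.
Qed.

Lemma sup_norm_le A f (M : R) : 0 <= M -> (forall t, A t -> `|f t| <= M) ->
  sup_norm A f <= M.
Proof.
move=> M0 fM; have [->|/set0P[t At]] := eqVneq A set0.
  by rewrite /sup_norm image_set0 sup0.
by apply: ge_sup => [|_ [s As <-]]; [exists `|f t|, t | exact: fM].
Qed.

Lemma sup_norm_ge0 A f : [bounded f t | t in A] -> 0 <= sup_norm A f.
Proof.
move=> bf; have [->|/set0P[t At]] := eqVneq A set0.
  by rewrite /sup_norm image_set0 sup0.
exact: le_trans (le_sup_norm bf At).
Qed.

Lemma sup_normD A f g : [bounded f t | t in A] -> [bounded g t | t in A] ->
  sup_norm A (f + g) <= sup_norm A f + sup_norm A g.
Proof.
move=> bf bg; apply: sup_norm_le => [|t At].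
  by rewrite addr_ge0 ?sup_norm_ge0.
by rewrite (le_trans (ler_normD _ _))// lerD// le_sup_norm.
Qed.

Lemma sup_normZ A (a : R) f : [bounded f t | t in A] ->
  sup_norm A (a *: f) = `|a| * sup_norm A f.
Proof.
move=> bf; have baf := bounded_inZ a bf.
apply/eqP; rewrite eq_le; apply/andP; split.
  apply: sup_norm_le => [|t At]; first by rewrite mulr_ge0 ?sup_norm_ge0.
  by rewrite normrZ ler_wpM2l// le_sup_norm.
have [->|a0] := eqVneq a 0.
  rewrite normr0 mul0r scale0r sup_norm_ge0//.
  by apply/bounded_inP; exists 0 => t _; rewrite normr0.
rewrite -ler_pdivlMl ?normr_gt0//; apply: sup_norm_le => [|t At].
  by rewrite mulr_ge0 ?invr_ge0 ?sup_norm_ge0.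
by rewrite ler_pdivlMl ?normr_gt0// -normrZ (le_sup_norm baf).
Qed.

End sup_norm.

Definition bounded_pred {R : realType} {T : Type} {V : normedModType R} :
    {pred T -> V} :=
  fun f => `[< bounded_fun f >].

Lemma bounded_pred_submod {R : realType} {T : Type} {V : normedModType R} :
  submod_closed (@bounded_pred R T V).
Proof.
split=> [|a f g /asboolP bf /asboolP bg]; apply/asboolP.
  by apply/bounded_inP; exists 0 => t _; rewrite normr0.
by apply: bounded_inD => //; exact: bounded_inZ.
Qed.

HB.instance Definition _ {R : realType} {T : Type} {V : normedModType R} :=
  GRing.isSubmodClosed.Build R (T -> V) (@bounded_pred R T V)
    bounded_pred_submod.

Record ell_infty {R : realType} (T : Type) (V : normedModType R) := EllInfty {
  ell_infty_fun :> T -> V ;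
  ell_infty_funP : ell_infty_fun \in bounded_pred }.

Section ell_infty.
Context {R : realType} {T : Type} {V : normedModType R}.
Local Notation E := (@ell_infty R T V).
Implicit Types f g : E.

HB.instance Definition _ := [isSub of E for @ell_infty_fun R T V].
HB.instance Definition _ := [Choice of E by <:].
HB.instance Definition _ := [SubChoice_isSubLmodule of E by <:].

Definition ell_infty_norm f : R := sup_norm setT f.

Let bounded f : bounded_fun f.
Proof. exact/asboolP/ell_infty_funP. Qed.

Let normD f g : ell_infty_norm (f + g) <= ell_infty_norm f + ell_infty_norm g.
Proof. by apply: sup_normD; exact: bounded. Qed.

Let normZ (a : R) f : ell_infty_norm (a *: f) = `|a| * ell_infty_norm f.
Proof. by apply: sup_normZ; exact: bounded. Qed.

Let norm_eq0 f : ell_infty_norm f = 0 -> f = 0.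
Proof.
move=> f0; apply/val_inj; apply: funext => t; apply/eqP.
rewrite -normr_le0 -f0; apply: le_sup_norm => //; exact: bounded.
Qed.

HB.instance Definition _ := Lmodule_isNormed.Build R E normD normZ norm_eq0.

End ell_infty.

Definition continuous_linear_pred {R : realType} {X : normedModType R} :
    {pred X -> R^o} :=
  fun phi => `[< linear phi /\ continuous phi >].

Lemma continuous_linear_pred_submod {R : realType} {X : normedModType R} :
  submod_closed (@continuous_linear_pred R X).
Proof.
split=> [|a f g /asboolP[lf cf] /asboolP[lg cg]]; apply/asboolP; split.
- by move=> a x y; rewrite /= scaler0 addr0.
- by move=> x; exact: cst_continuous.
- move=> b x y.
  change (a *: f (b *: x + y) + g (b *: x + y) =
    b *: (a *: f x + g x) + (a *: f y + g y)).
  by rewrite lf lg !scalerDr !scalerA (mulrC a b) addrACA.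
- move=> x; apply: (@continuousD R R^o X (a *: f) g x); last exact: cg.
  by apply: (@continuousZl_tmp R R^o X f a x); exact: cf.
Qed.

HB.instance Definition _ {R : realType} {X : normedModType R} :=
  GRing.isSubmodClosed.Build R (X -> R^o) (@continuous_linear_pred R X)
    continuous_linear_pred_submod.

Record dual {R : realType} (X : normedModType R) := Dual {
  dual_fun :> X -> R^o ;
  dual_funP : dual_fun \in continuous_linear_pred }.

Section dual.
Context {R : realType} {X : normedModType R}.
Local Notation X' := (@dual R X).
Implicit Types phi psi : X'.

HB.instance Definition _ := [isSub of X' for @dual_fun R X].
HB.instance Definition _ := [Choice of X' by <:].
HB.instance Definition _ := [SubChoice_isSubLmodule of X' by <:].

Definition dual_norm phi : R := sup_norm [set x | `|x| <= 1] phi.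

Lemma dual_linear phi : linear phi.
Proof. by have /asboolP[] := dual_funP phi. Qed.

HB.instance Definition _ phi :=
  GRing.isLinear.Build R X R^o *:%R (phi : X -> R^o) (dual_linear phi).

Lemma dual_continuous phi : continuous phi.
Proof. by have /asboolP[] := dual_funP phi. Qed.

Lemma dual_bounded phi : [bounded phi x | x in [set x | `|x| <= 1]].
Proof.
have /linear_bounded_continuous/bounded_funP/(_ 1)[M phiM] :=
  @dual_continuous phi.
by apply/bounded_inP; exists M.
Qed.

Let normD phi psi : dual_norm (phi + psi) <= dual_norm phi + dual_norm psi.
Proof. by apply: sup_normD; exact: dual_bounded. Qed.

Let normZ (a : R) phi : dual_norm (a *: phi) = `|a| * dual_norm phi.
Proof. by apply: sup_normZ; exact: dual_bounded. Qed.

Let norm_eq0 phi : dual_norm phi = 0 -> phi = 0.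
Proof.
move=> phi0; apply/val_inj; apply: funext => x /=.
have [->|x0] := eqVneq x 0; first by rewrite linear0.
have : `|phi (`|x|^-1 *: x)| <= 0.
  rewrite -phi0; apply: le_sup_norm; first exact: dual_bounded.
  by rewrite /= normrZ normfV normr_id mulVf ?normr_eq0.
rewrite normr_le0 linearZ scaler_eq0 invr_eq0 normr_eq0 (negPf x0)/=.
by move=> /eqP.
Qed.

HB.instance Definition _ := Lmodule_isNormed.Build R X' normD normZ norm_eq0.

End dual.

(* {ptws X -> R^o} carries the product topology, so this is the coarsest
   topology on the dual making every evaluation phi |-> phi x continuous. *)
Definition weak_star {R : realType} (X : normedModType R) : Type :=
  @initial_topology (dual X) {ptws X -> R^o} (@dual_fun R X).

Definition finite_dimensional {R : realType} {V : lmodType R} (L : set V) :=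
  exists (n : nat) (e : 'I_n -> V), (forall i, L (e i)) /\
    forall x, L x -> exists c : 'I_n -> R, x = \sum_(i < n) c i *: e i.

Definition spaceable {R : realType} {V : normedModType R} (M : set V) :=
  exists L : {pred V}, [/\ submod_closed L, closed [set` L],
    ~ finite_dimensional [set` L] & [set` L] `<=` M `|` [set 0]].

Definition unit_interval (R : realType) : set R := `[0, 1].
Arguments unit_interval R : clear implicits.

(* tp_tag_in makes tp_point strictly increasing, so the intervals between
   consecutive points are non-overlapping and, with tp_point0 and tp_point1,
   cover [0, 1]; tp_point0 and tp_point1 also force tp_size > 0. *)
Record tagged_partition (R : realType) := TaggedPartition {
  tp_size : nat ;
  tp_point : 'I_tp_size.+1 -> R ;
  tp_tag : 'I_tp_size -> unit_interval R ;
  tp_point0 : tp_point ord0 = 0 ;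
  tp_point1 : tp_point ord_max = 1 ;
  tp_tag_in : forall i, tp_point (widen_ord (leqnSn _) i) < set_val (tp_tag i)
                        < tp_point (lift ord0 i) }.

Definition tp_length {R : realType} (P : tagged_partition R)
    (i : 'I_(tp_size P)) : R :=
  tp_point (lift ord0 i) - tp_point (widen_ord (leqnSn _) i).

Definition tp_norm {R : realType} (P : tagged_partition R) : R :=
  \big[Num.max/0]_(i < tp_size P) tp_length i.

Definition riemann_sum {R : realType} {Z : normedModType R}
    (f : unit_interval R -> Z) (P : tagged_partition R) : Z :=
  \sum_(i < tp_size P) tp_length i *: f (tp_tag i).

Definition riemann_integral_is {R : realType} {Z : normedModType R}
    (f : unit_interval R -> Z) (z : Z) :=
  forall eps : R, 0 < eps -> exists2 delta : R, 0 < delta &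
    forall P : tagged_partition R, tp_norm P < delta ->
      `|riemann_sum f P - z| < eps.

Definition riemann_integrable {R : realType} {Z : normedModType R}
    (f : unit_interval R -> Z) :=
  exists z : Z, riemann_integral_is f z.

(* Main.v *)
(* By the Josefson-Nissenzweig theorem there are functionals [y n], bounded and
   bounded away from 0 in norm, with [y n -> 0] weak*.  The function equal to a
   bump times [y n] near the middles of the intervals of the n-th level of a fat
   Cantor-like hierarchy is weak* continuous, but Riemann sums of level n can be
   moved by about [y n / 2] by changing tags.  Letting the coefficients range
   over bounded sequences that are constant on each of infinitely many infinite
   classes of levels gives a closed infinite-dimensional space.

   Josefson-Nissenzweig: pass from a sequence in the dual ball to sequences of
   midpoint-convex combinations of its tails whose weak* oscillation cannot be
   decreased further.  If some such oscillation is positive, averaging all the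
   leaves of a dyadic tree lets one vector split every leaf, and the Rademacher
   averages of the resulting functionals satisfy Bessel's inequality, hence are
   weak* null.  If it is 0, the combinations are weak* Cauchy, so either their
   differences give the sequence or they are norm Cauchy; in the latter case a
   norm-one sequence vanishing eventually on half-norming points of its own
   midpoint hull is weak* null. *)
Require Import Defs.
From HB Require Import structures.
From mathcomp Require Import all_boot all_order all_algebra.
From mathcomp Require Import all_classical all_reals all_analysis.
From mathcomp Require Import ring lra zify.
Import Order.TTheory GRing.Theory Num.Theory.
Import numFieldNormedType.Exports.

Set Implicit Arguments.
Unset Strict Implicit.
Unset Printing Implicit Defensive.

Local Open Scope classical_set_scope.
Local Open Scope ring_scope.

(** * Functionals on a normed space *)

Section dual_facts.
Context {R : realType} {X : normedModType R}.
Implicit Types (phi psi : dual X) (x y : X).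

Lemma dual_of_bounded (f : X -> R) (C : R) :
  (forall a x y, f (a *: x + y) = a * f x + f y) ->
  (forall x, `|f x| <= C * `|x|) -> exists phi : dual X, forall x, phi x = f x.
Proof.
move=> fL fC.
have linf : linear (f : X -> R^o) by move=> a x y; rewrite fL.
pose Lf := GRing.isLinear.Build R X R^o *:%R (f : X -> R^o) linf.
pose F : {linear X -> R^o} := HB.pack (f : X -> R^o) Lf.
have cF : continuous F.
  apply/linear_bounded_continuous/linear_boundedP; near=> M => x.
  apply: (le_trans (fC x)); rewrite ler_wpM2r//.
have pf : (f : X -> R^o) \in continuous_linear_pred by apply/asboolP; split.
by exists (Dual pf).
Unshelve. all: by end_near. Qed.

Lemma dual_add phi psi x : (phi + psi) x = phi x + psi x.
Proof. by []. Qed.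

Lemma dual_opp phi x : (- phi) x = - phi x.
Proof. by []. Qed.

Lemma dual_scale (a : R) phi x : (a *: phi) x = a * phi x.
Proof. by []. Qed.

Lemma dual_zero x : (0 : dual X) x = 0.
Proof. by []. Qed.

Lemma dual_le_norm phi x : `|phi x| <= `|phi| * `|x|.
Proof.
have [->|x0] := eqVneq x 0; first by rewrite linear0 !normr0 mulr0.
have nx : 0 < `|x| by rewrite normr_gt0.
rewrite -ler_pdivrMr//.
have -> : `|phi x| / `|x| = `|phi (`|x|^-1 *: x)|.
  by rewrite linearZ normrM normfV normr_id mulrC.
apply: le_sup_norm; first exact: dual_bounded.
by rewrite /= normrZ normfV normr_id mulVf// gt_eqF.
Qed.

Lemma dual_norm_le phi (C : R) : 0 <= C ->
  (forall x, `|x| <= 1 -> `|phi x| <= C) -> `|phi| <= C.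
Proof. exact: sup_norm_le. Qed.

(** The supremum in the dual norm need not be attained, whence the factor 2; passing to [- x]
    corrects the sign. *)
Lemma dual_half_norming phi :
  exists2 x, `|x| <= 1 & `|phi| <= 2 * phi x.
Proof.
have [->|phi0] := eqVneq phi 0; first by exists 0; rewrite ?normr0// linear0 mulr0.
apply: contrapT => nx; have := @dual_norm_le phi (`|phi| / 2) _ _.
have p0 : 0 < `|phi| by rewrite normr_gt0.
suff h x : `|x| <= 1 -> `|phi x| <= `|phi| / 2.
  by move=> /(_ (ltW _) h) H; have := H ltac:(lra); lra.
move=> x1; rewrite leNgt; apply/negP => h; apply: nx.
have [p|p] := leP 0 (phi x).
  by exists x => //; move: h; rewrite ger0_norm//; lra.
exists (- x); first by rewrite normrN.
by rewrite linearN; move: h; rewrite ltr0_norm//; lra.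
Qed.

End dual_facts.

(** * Hahn-Banach by minimal sublinear functionals *)

Section hahn_banach.
Context {R : realType} {X : normedModType R}.
Implicit Types (p q : X -> R) (x y : X).

Definition sublinear p :=
  (forall x y, p (x + y) <= p x + p y) /\
  (forall t x, 0 <= t -> p (t *: x) <= t * p x).

Lemma sublinearN p x : sublinear p -> - p (- x) <= p x.
Proof.
move=> [pD pZ]; have := pD x (- x); rewrite subrr.
have := pD 0 0; rewrite addr0; lra.
Qed.

(** For sublinear [p], the largest sublinear functional below [p] whose value at [- y] is at most
    [- p y]. *)
Definition directional_inf p y x : R :=
  inf [set p (x + t *: y) - t * p y | t in [set t | 0 <= t]].

Lemma directional_inf_le p y x t : sublinear p -> 0 <= t ->
  directional_inf p y x <= p (x + t *: y) - t * p y.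
Proof.
move=> sp t0; apply: ge_inf; last by exists t.
(* The infimum is finite because [s * p y <= p (s *: y) <= p (x + s *: y) + p (- x)]. *)
exists (- p (- x)) => _ [s /= s0 <-]; have [pD pZ] := sp.
have : p (s *: y) <= p (x + s *: y) + p (- x).
  by apply: le_trans (pD _ _); rewrite addrAC subrr add0r.
have : - p (- (s *: y)) <= p (s *: y) by exact: sublinearN.
have := pZ s y s0; have := pD (s *: y) (- (s *: y)).
have : s * p y <= p (s *: y).
  move: s0; rewrite le_eqVlt => /predU1P[<-|s0].
    by rewrite mul0r scale0r; have := pD 0 0; rewrite addr0; lra.
  rewrite -ler_pdivlMl//; apply: le_trans (pZ _ _ _); last by rewrite invr_ge0 ltW.
  by rewrite scalerA mulVf ?scale1r// gt_eqF.
lra.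
Qed.

Lemma le_directional_inf p y x M :
  (forall t, 0 <= t -> M <= p (x + t *: y) - t * p y) ->
  M <= directional_inf p y x.
Proof.
move=> h; apply: lb_le_inf; first by exists (p (x + 0 *: y) - 0 * p y), 0 => /=.
by move=> _ [t t0 <-]; exact: h.
Qed.

Lemma sublinear_directional_inf p y : sublinear p ->
  sublinear (directional_inf p y).
Proof.
move=> sp; have [pD pZ] := sp; split=> [x x'|t x t0].
  rewrite -lerBlDr; apply: le_directional_inf => t t0.
  rewrite lerBlDl -lerBlDr; apply: le_directional_inf => s s0.
  rewrite lerBlDr; apply: (le_trans (directional_inf_le _ _ sp (addr_ge0 t0 s0))).
  have := pD (x + t *: y) (x' + s *: y).
  by rewrite addrACA -scalerDl; lra.
move: t0; rewrite le_eqVlt => /predU1P[<-|t0].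
  rewrite scale0r mul0r; apply: (le_trans (directional_inf_le _ _ sp (lexx 0))).
  rewrite scale0r addr0 mul0r subr0.
  by have := pZ 0 0 (lexx 0); rewrite scale0r mul0r.
rewrite -ler_pdivrMl//; apply: le_directional_inf => s s0; rewrite ler_pdivrMl//.
have ts : 0 <= t * s by rewrite mulr_ge0// ltW.
apply: (le_trans (directional_inf_le _ _ sp ts)).
by have := pZ t (x + s *: y) (ltW t0); rewrite scalerDr scalerA; lra.
Qed.

(** Zorn's lemma for the reversed pointwise order. The infimum over a chain is finite since each
    member is at least [- p0 (- x)], and subadditive since the smaller of two members serves both
    points. *)
Lemma minimal_sublinear p0 : sublinear p0 -> exists p,
  [/\ sublinear p, forall x, p x <= p0 x &
    forall q, sublinear q -> (forall x, q x <= p x) -> forall x, p x <= q x].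
Proof.
move=> sp0; pose T := {p : X -> R | sublinear p /\ forall x, p x <= p0 x}.
pose le (p q : T) := `[< forall x, sval q x <= sval p x >].
have t0 : T by exists p0; split.
have [| | |p pmax] := @ZL_preorder T t0 le.
- by move=> p; apply/asboolP.
- move=> p q r /asboolP pq /asboolP qr; apply/asboolP => x.
  exact: le_trans (qr x) (pq x).
- move=> A totA; have [A0|/set0P[a Aa]] := eqVneq A set0.
    by exists t0 => s; rewrite A0.
  pose m x := inf [set sval p x | p in A].
  have mle x (p : T) : A p -> m x <= sval p x.
    move=> Ap; apply: ge_inf; last by exists p.
    exists (- p0 (- x)) => _ [q Aq <-]; have [sq qp0] := svalP q.
    by have := sublinearN x sq; have := qp0 (- x); lra.
  have le_m x M : (forall p : T, A p -> M <= sval p x) -> M <= m x.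
    move=> h; apply: lb_le_inf; first by exists (sval a x), a.
    by move=> _ [p Ap <-]; exact: h.
  have sm : sublinear m.
    split=> [x y|t x].
      rewrite -lerBlDr; apply: (le_m x) => p Ap.
      rewrite lerBlDl -lerBlDr; apply: (le_m y) => q Aq; rewrite lerBlDr.
      have [[pD _] _] := svalP p; have [[qD _] _] := svalP q.
      have [/asboolP pq|/asboolP qp] := totA p q Ap Aq.
        have := mle (x + y) q Aq; have := qD x y; have := pq x; lra.
      have := mle (x + y) p Ap; have := pD x y; have := qp y; lra.
    rewrite le_eqVlt => /predU1P[<-|t0'].
      rewrite mul0r; apply: (le_trans (mle _ a Aa)).
      by have [[_ aZ] _] := svalP a; have := aZ 0 x (lexx 0); rewrite mul0r.
    rewrite -ler_pdivrMl//; apply: (le_m x) => p Ap; rewrite ler_pdivrMl//.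
    apply: (le_trans (mle _ p Ap)).
    by have [[_ pZ] _] := svalP p; apply: pZ; exact: ltW.
  have mp0 x : m x <= p0 x.
    by apply: (le_trans (mle x a Aa)); have [_] := svalP a.
  by exists (exist _ m (conj sm mp0)) => s As; apply/asboolP => x; exact: mle.
have [sp pp0] := svalP p; exists (sval p); split=> // q sq qp.
have qp0 x : q x <= p0 x := le_trans (qp x) (pp0 x).
have /asboolP/= := pmax (exist _ q (conj sq qp0)) ltac:(exact/asboolP).
by [].
Qed.

(* A minimal sublinear functional is linear, because replacing it by its
   [directional_inf] in any direction cannot decrease it. *)
Lemma hahn_banach_separation x0 : exists phi : dual X, `|x0| <= phi x0.
Proof.
have sn : sublinear (fun x : X => `|x|).
  by split=> [x y|t x t0]; [exact: ler_normD|rewrite normrZ ger0_norm].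
(* Starting below this functional, and not merely below the norm, forces [p (- x0)] to be at most
   minus the norm of [x0]. *)
have sq := sublinear_directional_inf x0 sn.
have [p [sp pq pmin]] := minimal_sublinear sq.
have pn x : p x <= `|x|.
  apply: (le_trans (pq x)); apply: (le_trans (directional_inf_le _ _ sn (lexx 0))).
  by rewrite scale0r addr0 mul0r subr0.
have [pD pZ] := sp.
have padd x y : p (x + y) = p x + p y.
  apply/eqP; rewrite eq_le pD/=.
  have := pmin _ (sublinear_directional_inf y sp) _ x.
  have dp z : directional_inf p y z <= p z.
    apply: (le_trans (directional_inf_le _ _ sp (lexx 0))).
    by rewrite scale0r addr0 mul0r subr0.
  move=> /(_ dp); have := directional_inf_le y x sp ler01.
  by rewrite scale1r mul1r; lra.
have p0 : p 0 = 0 by have := padd 0 0; rewrite addr0; lra.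
have pN x : p (- x) = - p x by have := padd x (- x); rewrite subrr p0; lra.
have pZE t x : p (t *: x) = t * p x.
  wlog t0 : t / 0 <= t => [h|].
    have [|/ltW t0] := leP 0 t; first exact: h.
    by have := h (- t); rewrite oppr_ge0 scaleNr pN mulNr => /(_ t0); lra.
  apply/eqP; rewrite eq_le pZ//=.
  by have := pZ t (- x) t0; rewrite scalerN !pN mulrN; lra.
have [||phi phiE] := @dual_of_bounded _ _ p 1.
- by move=> a x y; rewrite padd pZE.
- move=> x; rewrite mul1r ler_norml pn andbT.
  by have := pn (- x); rewrite pN normrN; lra.
exists phi; rewrite phiE.
have := pq (- x0); rewrite pN.
have := directional_inf_le x0 (- x0) sn ler01.
by rewrite scale1r addNr normr0 mul1r; lra.
Qed.

End hahn_banach.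

(** * Finite dimension and separating functionals *)

Section finite_dimension.
Context {R : realType}.

(** Induction on [n]: either the first functional vanishes on [L] and is dropped, or a vector where
    it is 1 is split off and the others separate its kernel. *)
Lemma finite_dimensional_separated (V : lmodType R) (L : set V) n
    (f : 'I_n -> V -> R) :
  L 0 -> (forall a x y, L x -> L y -> L (a *: x + y)) ->
  (forall i a x y, f i (a *: x + y) = a * f i x + f i y) ->
  (forall x, L x -> (forall i, f i x = 0) -> x = 0) -> finite_dimensional L.
Proof.
elim: n L f => [|n IH] L f L0 LL fL fsep.
  exists 0%N, (fun=> 0); split=> [[]//|x Lx]; exists (fun=> 0).
  by rewrite big_ord0; apply: fsep => // -[].
have f0 i : f i 0 = 0.
  by have := fL i 1 0 0; rewrite scale1r addr0 mul1r; lra.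
have [Lf|] := pselect (forall x, L x -> f ord0 x = 0).
  apply: (IH L (fun i => f (lift ord0 i))) => // x Lx fx; apply: fsep => // i.
  by case: (unliftP ord0 i) => [j ->|->]; [exact: fx|exact: Lf].
move=> /existsNP[v0 /not_implyP[Lv0 fv0]].
pose v := (f ord0 v0)^-1 *: v0.
have fZ i a x : f i (a *: x) = a * f i x.
  by have := fL i a x 0; rewrite addr0 f0 addr0.
have Lv : L v by rewrite /v -[_ *: _]addr0; exact: LL.
have fv : f ord0 v = 1 by rewrite /v fZ mulVf//; apply/eqP.
have [||||m [e [eL eS]]] :=
  IH (L `&` [set x | f ord0 x = 0]) (fun i => f (lift ord0 i)).
- by split=> //=; exact: f0.
- move=> a x y [Lx /= fx] [Ly /= fy]; split; first exact: LL.
  by rewrite /= fL fx fy mulr0 addr0.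
- by [].
- move=> x [Lx fx] h; apply: fsep => // i.
  by case: (unliftP ord0 i) => [j ->|->]; [exact: h|exact: fx].
exists m.+1, (fun i => if unlift ord0 i is Some j then e j else v); split.
  by move=> i; case: unliftP => [j _|_] //; have [] := eL j.
move=> x Lx.
have [|c xE] := eS (- f ord0 x *: v + x).
  by split; [exact: LL|rewrite /= fL fv mulr1 addNr].
exists (fun i => if unlift ord0 i is Some j then c j else f ord0 x).
rewrite big_ord_recl unlift_none.
under eq_bigr do rewrite liftK.
by rewrite -xE addrA -scalerDl subrr scale0r add0r.
Qed.

(** Functionals spanning the dual separate the points of [X] by Hahn-Banach, so finitely many would
    make [X] finite-dimensional. *)
Lemma not_finite_dimensional_dual (X : normedModType R) :
  ~ finite_dimensional [set: X] -> ~ finite_dimensional [set: dual X].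
Proof.
move=> infX [n [e [_ eS]]]; apply: infX.
apply: (@finite_dimensional_separated _ _ n (fun i x => e i x)) => //.
  by move=> i a x y; rewrite linearP.
move=> x _ ex; apply/eqP; rewrite -normr_le0.
have [phi] := hahn_banach_separation x; have [c ->] := eS phi I.
suff -> : (\sum_(i < n) c i *: e i) x = 0 by [].
elim/big_ind : _ => [|f g fx gx|i _]; first exact: dual_zero.
  by rewrite dual_add fx gx addr0.
by rewrite dual_scale ex mulr0.
Qed.

(** Otherwise the evaluations at the points of [s] would separate the dual and make it
    finite-dimensional. *)
Lemma annihilator_neq0 (X : normedModType R) (s : seq X) :
  ~ finite_dimensional [set: X] ->
  exists2 phi : dual X, `|phi| = 1 & forall x, x \in s -> phi x = 0.
Proof.
move=> infX; apply: contrapT => h.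
apply: (not_finite_dimensional_dual infX).
apply: (@finite_dimensional_separated (dual X) _ (size s)
  (fun i phi => phi s`_i)) => //.
move=> phi _ phis; apply: contrapT => /eqP phi0; apply: h.
exists (`|phi|^-1 *: phi); first by rewrite normrZ normfV normr_id mulVf ?normr_eq0.
move=> x /(nthP 0)[i si <-].
by rewrite dual_scale (phis (Ordinal si)) mulr0.
Qed.

End finite_dimension.

(** * Far blocks and oscillation *)

Section far_blocks.
Context {R : realType}.

Definition midconvex (V : lmodType R) (K : set V) :=
  forall u v, K u -> K v -> K (2^-1 *: (u + v)).

(** The intersection of all midpoint-convex sets containing the tail from [m] on; in this form
    membership is an induction principle. *)
Definition midhull (V : lmodType R) (F : nat -> V) (m : nat) : set V :=
  [set v | forall K, midconvex K -> (forall i, (m <= i)%N -> K (F i)) -> K v].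

Definition far_block (V : lmodType R) (G F : nat -> V) :=
  forall n, midhull F n (G n).

Definition frequently (P : nat -> Prop) :=
  forall N, exists2 n, (N <= n)%N & P n.

Lemma not_frequently P : ~ frequently P -> \forall n \near \oo, ~ P n.
Proof.
move=> /existsNP[N h]; exists N => // n /= Nn Pn; apply: h.
by exists n.
Qed.

Lemma frequently_near P Q : frequently P -> (\forall n \near \oo, Q n) ->
  frequently (fun n => P n /\ Q n).
Proof.
move=> fP [N _ NQ] M; have [n + Pn] := fP (maxn N M).
by rewrite geq_max => /andP[Nn Mn]; exists n => //; split=> //; exact: NQ.
Qed.

Lemma frequently_subseq P : frequently P ->
  exists sigma : nat -> nat, forall n, (n <= sigma n)%N /\ P (sigma n).
Proof.
move=> fP; have [|sigma sP] := @choice _ _ (fun n m => (n <= m)%N /\ P m).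
  by move=> n; have [m] := fP n; exists m.
by exists sigma.
Qed.

Section lmodule.
Context {V : lmodType R}.
Implicit Types (F G H : nat -> V).

Lemma midconvex_midhull F m : midconvex (midhull F m).
Proof.
by move=> u v hu hv K mK KF; apply: (mK _ _ (hu K mK KF) (hv K mK KF)).
Qed.

Lemma midhull_in F m i : (m <= i)%N -> midhull F m (F i).
Proof. by move=> mi K _; exact. Qed.

Lemma midhull_sub F G m k :
  (forall i, (m <= i)%N -> midhull F k (G i)) -> midhull G m `<=` midhull F k.
Proof. by move=> GF v; apply; [exact: midconvex_midhull|exact: GF]. Qed.

Lemma midhull_le F m k : (k <= m)%N -> midhull F m `<=` midhull F k.
Proof.
by move=> km; apply: midhull_sub => i mi; apply: midhull_in; exact: leq_trans mi.
Qed.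

Lemma far_block_refl F : far_block F F.
Proof. by move=> n; exact: midhull_in. Qed.

Lemma far_block_midhull G F m : far_block G F -> midhull G m `<=` midhull F m.
Proof. by move=> GF; apply: midhull_sub => i mi; exact: midhull_le (GF i). Qed.

Lemma far_block_trans G F H : far_block H G -> far_block G F -> far_block H F.
Proof. by move=> HG GF n; exact: (far_block_midhull GF). Qed.

Lemma far_block_subseq F (sigma : nat -> nat) :
  (forall n, n <= sigma n)%N -> far_block (F \o sigma) F.
Proof. by move=> h n; exact: midhull_in. Qed.

Lemma far_block_shift G F k : far_block G F ->
  far_block (fun n => G (n + k)%N) (fun n => F (n + k)%N).
Proof.
move=> GF n; apply: midhull_sub (GF (n + k)%N) => i ni.
have ki : (k <= i)%N by rewrite (leq_trans _ ni)// leq_addl.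
by rewrite -(subnK ki); apply: midhull_in; rewrite leq_subRL// addnC.
Qed.

End lmodule.

Context {X : normedModType R}.
Implicit Types (F G H : nat -> dual X) (x : X) (a d : R).

Lemma dual_midpoint (u v : dual X) x :
  (2^-1 *: (u + v)) x = 2^-1 * (u x + v x).
Proof. by []. Qed.

Lemma midconvex_dual_le x a : midconvex [set phi : dual X | phi x <= a].
Proof.
move=> u v; rewrite /mkset dual_midpoint.
by set p : R := u x; set q : R := v x; lra.
Qed.

Lemma midconvex_dual_ge x a : midconvex [set phi : dual X | a <= phi x].
Proof.
move=> u v; rewrite /mkset dual_midpoint.
by set p : R := u x; set q : R := v x; lra.
Qed.

Definition contractive F := forall n x, `|F n x| <= `|x|.

Lemma midhull_contractive F m phi x : contractive F -> midhull F m phi ->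
  `|phi x| <= `|x|.
Proof.
move=> cF hp; rewrite ler_norml; apply/andP; split.
  apply: (hp _ (@midconvex_dual_ge x (- `|x|))) => i _ /=.
  by have := cF i x; rewrite ler_norml => /andP[].
apply: (hp _ (@midconvex_dual_le x `|x|)) => i _ /=.
by have := cF i x; rewrite ler_norml => /andP[].
Qed.

Lemma far_block_contractive G F : far_block G F -> contractive F -> contractive G.
Proof. by move=> GF cF n x; exact: midhull_contractive (GF n). Qed.

Lemma midconvex_dual_lt x a : midconvex [set phi : dual X | phi x < a].
Proof.
move=> u v; rewrite /mkset dual_midpoint.
by set p : R := u x; set q : R := v x; lra.
Qed.

Lemma midconvex_dual_gt x a : midconvex [set phi : dual X | a < phi x].
Proof.
move=> u v; rewrite /mkset dual_midpoint.
by set p : R := u x; set q : R := v x; lra.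
Qed.

(** Half-spaces are midpoint convex: if [F n x > a] eventually, the same passes to the hulls of
    tails and so to [G]. *)
Lemma far_block_frequently_le G F x a : far_block G F ->
  frequently (fun n => G n x <= a) -> frequently (fun n => F n x <= a).
Proof.
move=> GF fG; apply: contrapT => /not_frequently[N _ NF].
have [n Nn] := fG N; apply/negP; rewrite -ltNge.
apply: (GF n _ (@midconvex_dual_gt x a)) => i /(leq_trans Nn) /NF /negP.
by rewrite -ltNge.
Qed.

Lemma far_block_frequently_ge G F x a : far_block G F ->
  frequently (fun n => a <= G n x) -> frequently (fun n => a <= F n x).
Proof.
move=> GF fG; apply: contrapT => /not_frequently[N _ NF].
have [n Nn] := fG N; apply/negP; rewrite -ltNge.
apply: (GF n _ (@midconvex_dual_lt x a)) => i /(leq_trans Nn) /NF /negP.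
by rewrite -ltNge.
Qed.

Definition oscillates F x a d :=
  frequently (fun n => F n x <= a) /\ frequently (fun n => a + d <= F n x).

Lemma far_block_oscillates G F x a d : far_block G F ->
  oscillates G x a d -> oscillates F x a d.
Proof.
by move=> GF [lo hi]; split;
  [exact: far_block_frequently_le lo|exact: far_block_frequently_ge hi].
Qed.

Lemma oscillates_le F x a d d' : d' <= d -> oscillates F x a d ->
  oscillates F x a d'.
Proof.
move=> dd [lo hi]; split=> // N; have [n Nn h] := hi N; exists n => //.
by apply: le_trans h; rewrite lerD2l.
Qed.

(** For contractive [F], the supremum over the unit ball of limsup minus liminf of [F n x]. *)
Definition oscillation F : R :=
  sup [set d | exists x a, `|x| <= 1 /\ oscillates F x a d].

Lemma oscillation_set_ub F : contractive F ->
  ubound [set d | exists x a, `|x| <= 1 /\ oscillates F x a d] 2.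
Proof.
move=> cF d [x [a [x1 [/(_ 0%N)[n _ lo] /(_ 0%N)[m _ hi]]]]].
have := cF n x; have := cF m x; move: lo hi; rewrite !ler_norml.
set p : R := F n x; set q : R := F m x => lo hi /andP[q1 q2] /andP[p1 p2].
lra.
Qed.

Lemma oscillates0 F : oscillates F 0 0 0.
Proof. by split=> N; exists N; rewrite ?addr0// linear0. Qed.

Lemma le_oscillation F x a d : contractive F -> `|x| <= 1 ->
  oscillates F x a d -> d <= oscillation F.
Proof.
move=> cF x1 h; apply: ub_le_sup; last by exists x, a.
by exists 2; exact: oscillation_set_ub.
Qed.

Lemma oscillation_ge0 F : contractive F -> 0 <= oscillation F.
Proof.
by move=> cF; apply: (le_oscillation cF _ (oscillates0 F)); rewrite normr0.
Qed.

Lemma oscillation_gt F d : contractive F -> d < oscillation F ->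
  exists x a, `|x| <= 1 /\ oscillates F x a d.
Proof.
move=> cF /sup_gt[|e [x [a [x1 h]]] de].
  by exists 0, 0, 0; rewrite normr0; split => //; exact: oscillates0.
by exists x, a; split=> //; apply: oscillates_le h; exact: ltW.
Qed.

Lemma far_block_oscillation G F : contractive F -> far_block G F ->
  oscillation G <= oscillation F.
Proof.
move=> cF GF; apply: ge_sup.
  by exists 0, 0, 0; rewrite normr0; split => //; exact: oscillates0.
move=> d [x [a [x1 h]]].
exact: (le_oscillation cF x1 (far_block_oscillates GF h)).
Qed.

Lemma oscillation_shift F k : oscillation (fun n => F (n + k)%N) = oscillation F.
Proof.
have fs (P : nat -> Prop) : frequently (fun n => P (n + k)%N) <-> frequently P.
  split=> fP N.
    have [n Nn Pn] := fP N; exists (n + k)%N => //.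
    by rewrite (leq_trans Nn)// leq_addr.
  have [n Nn Pn] := fP (N + k)%N; have kn := leq_trans (leq_addl N k) Nn.
  by exists (n - k)%N; rewrite ?subnK// leq_subRL// addnC.
congr sup; apply/seteqP; split=> d [x [a [x1 [lo hi]]]]; exists x, a; split=> //;
  by split; [apply/(fs (fun n => F n x <= a))|apply/(fs (fun n => a + d <= F n x))].
Qed.

(* Repeatedly passing to far blocks with nearly minimal oscillation and then to
   the diagonal yields a sequence whose oscillation no far block decreases. *)
Lemma stable_far_block F : contractive F -> exists G, far_block G F /\
  forall H, far_block H G -> oscillation H = oscillation G.
Proof.
move=> cF; pose low F := inf [set oscillation G | G in [set G | far_block G F]].
have low_le G H : contractive H -> far_block G H -> low H <= oscillation G.
  move=> cH GH; apply: ge_inf; last by exists G.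
  exists 0 => _ [K KH <-]; apply: oscillation_ge0.
  exact: far_block_contractive KH cH.
have [next nextP] : {next & forall kH : nat * (nat -> dual X),
    far_block (next kH) kH.2 /\
    oscillation (next kH) < low kH.2 + kH.1.+1%:R^-1}.
  apply: (@choice _ _ (fun kH G =>
    far_block G kH.2 /\ oscillation G < low kH.2 + kH.1.+1%:R^-1)) => -[k H] /=.
  have : low H < low H + k.+1%:R^-1 by rewrite ltrDl invr_gt0.
  move=> /inf_lt[|_ [G GH <-] lt]; last by exists G.
  by exists (oscillation H), H => //; exact: far_block_refl.
pose S := fix S k := if k is k'.+1 then next (k', S k') else F.
have S_le k j : far_block (S (k + j)%N) (S k).
  elim: j => [|j IH]; first by rewrite addn0; exact: far_block_refl.
  rewrite addnS; apply: far_block_trans IH.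
  by have [] := nextP ((k + j)%N, S (k + j)%N).
have cS k : contractive (S k) by apply: (far_block_contractive (S_le 0%N k)).
pose G n := S n n.
(* All later stages are far blocks of stage [k], so the diagonal from index [k] on is one too. *)
have GS k : far_block (fun n => G (n + k)%N) (S k).
  by move=> n; rewrite /G addnC; apply: (midhull_le (leq_addl k n)); exact: S_le.
have GF : far_block G F by move=> n; have := GS 0%N n; rewrite addn0.
have cG : contractive G := far_block_contractive GF cF.
exists G; split=> // H HG.
have cH : contractive H := far_block_contractive HG cG.
apply/eqP; rewrite eq_le far_block_oscillation//=.
apply/ler_addgt0Pr => e e0.
have [k ke] : exists k, k.+1%:R^-1 < e.
  exists (Num.truncn e^-1); rewrite invf_plt ?posrE//.
  by rewrite truncnS_gt// invr_ge0 ltW.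
(* Up to shifts, [G] and [H] are far blocks of every stage; the three bounds give [oscillation G <=
   oscillation H + k.+1%:R^-1]. *)
have h1 : oscillation G <= oscillation (S k.+1).
  by rewrite -(oscillation_shift G k.+1); exact: far_block_oscillation.
have h2 : low (S k) <= oscillation H.
  rewrite -(oscillation_shift H k); apply: low_le => //.
  by apply: far_block_trans (GS k); exact: far_block_shift.
have h3 : oscillation (S k.+1) < low (S k) + k.+1%:R^-1 := (nextP (k, S k)).2.
by rewrite (le_trans h1)// (le_trans (ltW h3))// lerD// ltW.
Qed.

End far_blocks.

(** * Weak* Cauchy sequences of functionals *)

Section weak_star_null.
Context {R : realType} {X : normedModType R}.
Implicit Types (F G : nat -> dual X) (x : X).

Definition josefson_nissenzweig_seq (y : nat -> dual X) :=
  [/\ exists C, forall n, `|y n| <= C,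
      exists2 c, 0 < c & forall n, c <= `|y n| &
      forall x, (y n x : R) @[n --> \oo] --> (0 : R)].

(** The limit is the limsup, [sup A]: values frequently at most [sup A - e] would give an
    oscillation of [e / 2]. *)
Lemma cvg_of_not_oscillating (u : nat -> R) (C : R) : (forall n, `|u n| <= C) ->
  (forall a d : R, 0 < d -> ~ (frequently (fun n => u n <= a) /\
                           frequently (fun n => a + d <= u n))) ->
  exists l : R, u n @[n --> \oo] --> l.
Proof.
move=> uC nosc; pose A := [set a | frequently (fun n => a <= u n)].
have AC : ubound A C.
  move=> a /(_ 0%N)[n _ an]; apply: (le_trans an).
  by rewrite (le_trans (ler_norm _)).
have A0 : A (- C).
  by move=> N; exists N => //; have := uC N; rewrite ler_norml => /andP[].
exists (sup A); apply/cvgrPdist_lt => e /= e0; have {}e0 : (0 : R) < (e : R) := e0.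
have up : \forall n \near \oo, u n < sup A + e.
  have : ~ frequently (fun n => sup A + e <= u n).
    move=> h; have : sup A + e <= sup A by apply: ub_le_sup => //; exists C.
    by rewrite gerDl leNgt e0.
  by move=> /not_frequently; apply: filterS => n /negP; rewrite -ltNge.
have dn : \forall n \near \oo, sup A - e < u n.
  have : ~ frequently (fun n => u n <= sup A - e).
    move=> lo; have [||a Aa lta] := @sup_gt _ A (sup A - e / 2).
    - by exists (- C).
    - by lra.
    apply: (nosc (sup A - e) (e / 2)); first by lra.
    split=> // N; have [n Nn an] := Aa N; exists n => //; lra.
  by move=> /not_frequently; apply: filterS => n /negP; rewrite -ltNge.
by apply: filterS2 up dn => n; rewrite ltr_norml; lra.
Qed.

Lemma weak_star_cvg_of_oscillation0 F x : contractive F -> oscillation F = 0 ->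
  exists l : R, (F n x : R) @[n --> \oo] --> l.
Proof.
move=> cF osc0; have n1 : 0 < `|x| + 1 by rewrite ltr_wpDl.
pose z := (`|x| + 1)^-1 *: x.
have z1 : `|z| <= 1.
  rewrite normrZ gtr0_norm ?invr_gt0// ler_pdivrMl// mulr1.
  by rewrite lerDl.
have [|a d d0 osc|l cl] := @cvg_of_not_oscillating (fun n => F n z) 1.
- by move=> n; apply: le_trans z1; exact: cF.
- by have := le_oscillation cF z1 osc; rewrite osc0; lra.
exists ((`|x| + 1) * l).
have -> : (fun n => F n x : R) = (fun n => (`|x| + 1) * F n z).
  by apply/funext => n; rewrite linearZ mulrA mulfV ?mul1r// gt_eqF.
exact: cvgMl_tmp.
Qed.

Lemma contractive_norm_le1 F n : contractive F -> `|F n| <= 1.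
Proof. by move=> cF; apply: dual_norm_le => // x; exact: le_trans. Qed.

Lemma contractiveP F : (forall n, `|F n| <= 1) -> contractive F.
Proof.
move=> F1 n x; rewrite (le_trans (dual_le_norm _ _))//.
by rewrite ler_piMl.
Qed.

(** If [F] is not norm Cauchy, each [F n] has a later term at distance above a fixed [e]; these
    differences stay away from 0 in norm, while their weak* limits cancel. *)
Lemma weak_star_cauchy_dichotomy F : contractive F ->
  (forall x, exists l : R, (F n x : R) @[n --> \oo] --> l) ->
  (exists y, josefson_nissenzweig_seq y) \/
  (forall e, 0 < e -> exists N, forall m, (N <= m)%N -> `|F N - F m| <= e).
Proof.
move=> cF cvgF.
have [|/existsNP[e /not_implyP[e0 /forallNP h]]] := pselect (forall e, 0 < e ->
  exists N, forall m, (N <= m)%N -> `|F N - F m| <= e); first by right.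
left; have [f fP] : {f : nat -> nat &
    forall N, (N <= f N)%N /\ e < `|F N - F (f N)| }.
  apply: (@choice _ _ (fun N m => (N <= m)%N /\ e < `|F N - F m|)) => N.
  have /existsNP[m /not_implyP[Nm /negP]] := h N.
  by rewrite -ltNge; exists m.
exists (fun n => F n - F (f n)); split.
- exists 2 => n; rewrite (le_trans (ler_normB _ _))//.
  by rewrite (_ : 2 = 1 + 1)// lerD// contractive_norm_le1.
- by exists e => // n; rewrite ltW//; have [] := fP n.
move=> x; have [l cl] := cvgF x; rewrite -(subrr l).
apply: cvgB => //; apply: (@cvg_comp _ _ _ f (fun n => F n x : R) _ \oo _ _ cl).
move=> A [N _ NA]; exists N => // n /= Nn; apply: NA => /=.
by apply: leq_trans Nn _; have [] := fP n.
Qed.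

End weak_star_null.

(** * A normalised sequence killing half-norming points *)

Section spread_sequence.
Context {R : realType} {X : normedModType R}.

Definition midpoints (V : lmodType R) (s : seq V) : seq V :=
  s ++ [seq 2^-1 *: (u + v) | u <- s, v <- s].

Lemma mem_iter_midpoints (V : lmodType R) d d' (s s' : seq V) :
  (d <= d')%N -> {subset s <= s'} ->
  {subset iter d (@midpoints V) s <= iter d' (@midpoints V) s'}.
Proof.
have mono k (r r' : seq V) : {subset r <= r'} ->
    {subset iter k (@midpoints V) r <= iter k (@midpoints V) r'}.
  elim: k => //= k IH rr' v; rewrite !mem_cat => /orP[/(IH rr')->//|].
  move=> /allpairsP[[a b] [/= /(IH rr') ar /(IH rr') br ->]].
  by apply/orP; right; apply/allpairsP; exists (a, b).
move=> /subnK <- ss'; rewrite iterD => v /(mono d _ _ ss').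
by elim: (d' - d)%N => //= k IH vs; rewrite mem_cat IH.
Qed.

(* Each functional vanishes on half-norming points of all the midpoints of
   bounded depth built from its predecessors, so that every element of the
   midpoint hull has a half-norming point killed by almost all functionals. *)
Lemma spread_sequence : ~ finite_dimensional [set: X] ->
  exists phi : nat -> dual X, (forall n, `|phi n| = 1) /\
    forall psi, midhull phi 0 psi -> exists x, [/\ `|x| <= 1,
      `|psi| <= 2 * psi x & \forall n \near \oo, phi n x = 0].
Proof.
move=> infX.
have [nm nmP] : {nm : dual X -> X &
    forall phi, `|nm phi| <= 1 /\ `|phi| <= 2 * phi (nm phi)}.
  apply: (@choice (dual X) X (fun phi x => `|x| <= 1 /\ `|phi| <= 2 * phi x)).
  move=> phi; by have [x] := dual_half_norming phi; exists x.
have [ann annP] : {ann : seq X -> dual X &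
    forall s, `|ann s| = 1 /\ forall x, x \in s -> ann s x = 0}.
  apply: (@choice (seq X) (dual X)
    (fun s phi => `|phi| = 1 /\ forall x, x \in s -> phi x = 0)).
  by move=> s; have [phi] := annihilator_neq0 s infX; exists phi.
(* [st n] lists the functionals [phi i] with [i < n], and [phi n] kills half-norming points of all
   their midpoints of depth at most [n]. *)
pose pts n (s : seq (dual X)) := map nm (iter n (@midpoints (dual X)) s).
pose st := fix st n : seq (dual X) :=
  if n is n'.+1 then rcons (st n') (ann (pts n' (st n'))) else [::].
pose phi n := ann (pts n (st n)).
have st_sub m n : (m <= n)%N -> {subset st m <= st n}.
  move=> /subnK <-; elim: (n - m)%N => //= k IH v /IH vs.
  by rewrite mem_rcons in_cons vs orbT.
exists phi; split=> [n|psi hpsi]; first by have [] := annP (pts n (st n)).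
have [d [m psiS]] : exists d m, psi \in iter d (@midpoints (dual X)) (st m).
  apply: (hpsi [set psi | exists d m, psi \in iter d (@midpoints (dual X)) (st m)]).
    move=> u v /= [d [m um]] [d' [m' vm]]; exists (maxn d d').+1, (maxn m m').
    rewrite /= mem_cat; apply/orP; right; apply/allpairsP; exists (u, v).
    split=> //=.
      by apply: mem_iter_midpoints um; [exact: leq_maxl|exact/st_sub/leq_maxl].
    by apply: mem_iter_midpoints vm; [exact: leq_maxr|exact/st_sub/leq_maxr].
  by move=> i _; exists 0%N, i.+1; rewrite /= mem_rcons mem_head.
have [nm1 nm2] := nmP psi; exists (nm psi); split=> //.
exists (maxn d m) => // n /=; rewrite geq_max => /andP[dn mn].
have [_] := annP (pts n (st n)); apply; apply: map_f.
by apply: mem_iter_midpoints psiS => //; exact: st_sub.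
Qed.

End spread_sequence.

(** * Dyadic trees of functionals *)

Section dyadic_averages.
Context {R : realType}.

Fixpoint dyadic_avg (V : lmodType R) N (c : seq bool -> V) : V :=
  if N is N'.+1 then 2^-1 *: (dyadic_avg N' (c \o cons true) +
                              dyadic_avg N' (c \o cons false))
  else c [::].

(* The average of [c s] over the words [s] of length [N], weighted by the sign
   given by the [k]-th letter of [s]. *)
Fixpoint rademacher (V : lmodType R) N k (c : seq bool -> V) : V :=
  if N is N'.+1 then
    if k is k'.+1 then 2^-1 *: (rademacher N' k' (c \o cons true) +
                                rademacher N' k' (c \o cons false))
    else 2^-1 *: (dyadic_avg N' (c \o cons true) - dyadic_avg N' (c \o cons false))
  else 0.

Lemma dyadic_avg_midconvex (V : lmodType R) (K : set V) N (c : seq bool -> V) :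
  midconvex K -> (forall s, size s = N -> K (c s)) -> K (dyadic_avg N c).
Proof.
move=> mK; elim: N c => [|N IH] c Kc /=; first exact: Kc.
by apply: mK; apply: IH => s sN; apply: Kc; rewrite /= sN.
Qed.

Lemma dyadic_avg_le N (c : seq bool -> R^o) (a : R) :
  (forall s, size s = N -> c s <= a) -> dyadic_avg N c <= a.
Proof.
apply: (@dyadic_avg_midconvex R^o [set x | x <= a]).
by move=> u v /=; rewrite /GRing.scale/=; lra.
Qed.

Lemma dyadic_avg_ge N (c : seq bool -> R^o) (a : R) :
  (forall s, size s = N -> a <= c s) -> a <= dyadic_avg N c.
Proof.
apply: (@dyadic_avg_midconvex R^o [set x | a <= x]).
by move=> u v /=; rewrite /GRing.scale/=; lra.
Qed.

(** No leaf is below [b], so the total excess, at most [2 ^+ N * eta], bounds the excess of each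
    single leaf. *)
Lemma dyadic_avg_le_each N (c : seq bool -> R^o) (b eta : R) :
  (forall s, size s = N -> b <= c s) -> dyadic_avg N c <= b + eta ->
  forall s, size s = N -> c s <= b + 2 ^+ N * eta.
Proof.
elim: N c eta => [|N IH] c eta bc avg s.
  by move=> /size0nil ->; move: avg; rewrite expr0 mul1r.
have ht := dyadic_avg_ge (fun s sN => bc (true :: s) (congr1 S sN)).
have hf := dyadic_avg_ge (fun s sN => bc (false :: s) (congr1 S sN)).
move: avg ht hf; rewrite /= /GRing.scale/= => avg ht hf.
case: s => // -[] s [sN]; rewrite exprSr -mulrA;
  apply: (IH (c \o cons _)) => // [t tN|]; by [apply: bc; rewrite /= tN|lra].
Qed.

Lemma dyadic_avg_ge_each N (c : seq bool -> R^o) (b eta : R) :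
  (forall s, size s = N -> c s <= b) -> b - eta <= dyadic_avg N c ->
  forall s, size s = N -> b - 2 ^+ N * eta <= c s.
Proof.
elim: N c eta => [|N IH] c eta bc avg s.
  by move=> /size0nil ->; move: avg; rewrite expr0 mul1r.
have ht := dyadic_avg_le (fun s sN => bc (true :: s) (congr1 S sN)).
have hf := dyadic_avg_le (fun s sN => bc (false :: s) (congr1 S sN)).
move: avg ht hf; rewrite /= /GRing.scale/= => avg ht hf.
case: s => // -[] s [sN]; rewrite exprSr -mulrA;
  apply: (IH (c \o cons _)) => // [t tN|]; by [apply: bc; rewrite /= tN|lra].
Qed.

(** The centre [r] cancels in the half difference of the averages over the two values of the [k]-th
    letter. *)
Lemma rademacher_ge N k (c : seq bool -> R^o) (r d : R) : (k < N)%N ->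
  (forall s, size s = N ->
    if nth false s k then r + d <= c s else c s <= r - d) ->
  d <= rademacher N k c.
Proof.
elim: N k c => // N IH [|k] c kN h.
  have ht : r + d <= dyadic_avg N (c \o cons true).
    by apply: dyadic_avg_ge => s sN; apply: (h (true :: s)); rewrite /= sN.
  have hf : dyadic_avg N (c \o cons false) <= r - d.
    by apply: dyadic_avg_le => s sN; apply: (h (false :: s)); rewrite /= sN.
  by move: ht hf; rewrite /= /GRing.scale/=; lra.
have := IH k (c \o cons true) kN (fun s sN => h (true :: s) (congr1 S sN)).
have := IH k (c \o cons false) kN (fun s sN => h (false :: s) (congr1 S sN)).
by rewrite /= /GRing.scale/=; lra.
Qed.

(** Bessel's inequality for the constant 1 and the Rademacher functions on words. The parallelogram
    law handles the first letter, convexity of the square the remaining coefficients. *)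
Lemma rademacher_bessel N K (c : seq bool -> R^o) :
  dyadic_avg N c ^+ 2 + \sum_(k < K) rademacher N k c ^+ 2 <=
  dyadic_avg N (fun s => c s ^+ 2 : R^o).
Proof.
elim: N K c => [|N IH] K c /=; first by rewrite big1 ?addr0// => k _; rewrite expr0n.
case: K => [|K].
  have := IH 0%N (c \o cons true); have := IH 0%N (c \o cons false).
  rewrite !big_ord0 !addr0 /GRing.scale/=.
  move: (dyadic_avg N (c \o cons true) : R) (dyadic_avg N (c \o cons false) : R).
  rewrite -/(comp (fun s => c s ^+ 2) (cons true)).
  rewrite -/(comp (fun s => c s ^+ 2) (cons false)).
  by move=> p q; have := sqr_ge0 (p - q); nra.
rewrite big_ord_recl /=.
have := IH K (c \o cons true); have := IH K (c \o cons false).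
have sumle : \sum_(i < K)
    (2^-1 *: (rademacher N i (c \o cons true) +
              rademacher N i (c \o cons false))) ^+ 2 <=
    2^-1 * (\sum_(i < K) rademacher N i (c \o cons true) ^+ 2 +
            \sum_(i < K) rademacher N i (c \o cons false) ^+ 2).
  rewrite -big_split mulr_sumr; apply: ler_sum => i _; rewrite /GRing.scale/=.
  move: (rademacher N i (c \o cons true) : R).
  move: (rademacher N i (c \o cons false) : R).
  by move=> p q; have := sqr_ge0 (p - q); nra.
move: sumle; rewrite /GRing.scale/=.
set S1 := \sum_(i < K) _; set S2 := \sum_(i < K) _; set S3 := \sum_(i < K) _.
rewrite -/(comp (fun s => c s ^+ 2) (cons true)).
rewrite -/(comp (fun s => c s ^+ 2) (cons false)).
move: (dyadic_avg N (c \o cons true) : R) (dyadic_avg N (c \o cons false) : R).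
by move=> p q; rewrite /bump/=; nra.
Qed.

Lemma dyadic_avg_eval (X : normedModType R) N (c : seq bool -> dual X) x :
  (dyadic_avg N c) x = dyadic_avg N (fun s => c s x : R^o).
Proof.
elim: N c => // N IH c; rewrite [dyadic_avg N.+1 c]lock /= -lock.
by rewrite dual_midpoint !IH.
Qed.

Lemma rademacher_eval (X : normedModType R) N k (c : seq bool -> dual X) x :
  (rademacher N k c) x = rademacher N k (fun s => c s x : R^o).
Proof.
elim: N k c => // N IH [|k] c; rewrite [rademacher N.+1 _ c]lock /= -lock.
  by rewrite dual_midpoint dual_opp !dyadic_avg_eval.
by rewrite dual_midpoint !IH.
Qed.

End dyadic_averages.

(** * Splitting all leaves of a dyadic tree by one vector *)

Section independent_tree.
Context {R : realType} {X : normedModType R}.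
Variable F : nat -> dual X.
Hypothesis cF : contractive F.
Hypothesis stableF : forall G, far_block G F -> oscillation G = oscillation F.
Hypothesis osc_gt0 : 0 < oscillation F.

Let delta : R := oscillation F.

(* A vector on which the average of all the leaves oscillates by almost
   [delta] makes every leaf oscillate between the same two values, since no
   single leaf can oscillate by more than [delta]. *)
Lemma split_leaves N (a : seq bool -> nat -> nat) :
  (forall s n, n <= a s n)%N ->
  exists x r (p : bool -> nat -> nat), [/\ `|x| <= 1, forall b n, (n <= p b n)%N &
    forall s n, size s = N -> r + delta / 4 <= F (a s (p true n)) x /\
      F (a s (p false n)) x <= r - delta / 4].
Proof.
move=> an.
have N0 : (0 : R) < 2 ^+ N by rewrite exprn_gt0.
have d0 : 0 < delta := osc_gt0.
(* The average will come within [2 * e] of the extreme values [A + delta + e] and [A - 2 * e], hence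
   each leaf within [delta / 6], which keeps it at least [delta / 4] away from [A + delta / 2]. *)
have [e e0 eN] : exists2 e : R, 0 < e & 2 ^+ N * (2 * e) = delta / 6.
  exists (delta / (12 * 2 ^+ N)); first by rewrite divr_gt0// mulr_gt0.
  by move: (2 ^+ N) N0 => M M0; field; rewrite gt_eqF.
pose G n := dyadic_avg N (fun s => F (a s n)).
have GF : far_block G F.
  move=> n; apply: dyadic_avg_midconvex => [|s _]; first exact: midconvex_midhull.
  exact: midhull_in.
have [x [A [x1 oscG]]] : exists x A, `|x| <= 1 /\ oscillates G x A (delta - e).
  apply: oscillation_gt; first exact: far_block_contractive GF cF.
  by rewrite stableF// gtrBl.
have [loF hiF] := far_block_oscillates GF oscG; have [loG hiG] := oscG.
have nosc B d : delta < d -> ~ oscillates F x B d.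
  by move=> dd h; have := le_oscillation cF x1 h; rewrite leNgt dd.
(* [F] is frequently at most [A] and frequently at least [A + delta - e]; crossing [A - 2 * e] or
   [A + delta + e] frequently would produce an oscillation of [delta + e]. *)
have evlo : \forall n \near \oo, forall s, A - 2 * e <= F (a s n) x.
  have : ~ frequently (fun n => F n x <= A - 2 * e).
    move=> loF'; apply: (@nosc (A - 2 * e) (delta + e)); first by rewrite ltrDl.
    split=> // M; have [n Mn hi] := hiF M; exists n => //.
    by apply: le_trans hi; lra.
  move=> /not_frequently[M _ MF]; exists M => // n /= Mn s.
  by apply/ltW; rewrite ltNge; apply/negP/MF; exact: leq_trans (an s n).
have evhi : \forall n \near \oo, forall s, F (a s n) x <= A + delta + e.
  have : ~ frequently (fun n => A + (delta + e) <= F n x).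
    by move=> h; apply: (@nosc A (delta + e)); rewrite ?ltrDl.
  move=> /not_frequently[M _ MF]; exists M => // n /= Mn s.
  apply/ltW; rewrite ltNge -addrA; apply/negP/MF; exact: leq_trans (an s n).
have Gx n : G n x = dyadic_avg N (fun s => F (a s n) x : R^o).
  exact: dyadic_avg_eval.
have [p1 p1P] := frequently_subseq (frequently_near hiG evhi).
have [p0 p0P] := frequently_subseq (frequently_near loG evlo).
exists x, (A + delta / 2), (fun b => if b then p1 else p0); split=> //.
  by move=> [] n; [have [] := p1P n|have [] := p0P n].
move=> s n sN; split.
  have [_ [hi hi']] := p1P n.
  have := @dyadic_avg_ge_each R N (fun s => F (a s (p1 n)) x : R^o)
    (A + delta + e) (2 * e) (fun s _ => hi' s) _ s sN.
  rewrite -Gx eN => h.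
  by apply: le_trans (h _); move: hi; set u : R := G _ x; lra.
have [_ [lo lo']] := p0P n.
have := @dyadic_avg_le_each R N (fun s => F (a s (p0 n)) x : R^o)
  (A - 2 * e) (2 * e) (fun s _ => lo' s) _ s sN.
rewrite -Gx eN => h.
by apply: (le_trans (h _)); move: lo; set u : R := G _ x; lra.
Qed.

(** The splitting is iterated: each child leaf takes its indices from its parent, so earlier splits
    persist. [y N k] is the [k]-th Rademacher average of one functional from each leaf of length
    [N]. *)
Lemma rademacher_functionals : exists (x : nat -> X) (y : nat -> nat -> dual X),
  [/\ forall k, `|x k| <= 1,
      forall N k, (k < N)%N -> delta / 4 <= y N k (x k) &
      forall N K z, \sum_(k < K) (y N k z : R) ^+ 2 <= `|z| ^+ 2].
Proof.
pose T := {a : seq bool -> nat -> nat | forall s n, (n <= a s n)%N}.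
pose side (b : bool) (r u : R) :=
  if b then r + delta / 4 <= u else u <= r - delta / 4.
have [f fP] : {f : nat * T -> X * R * T & forall Na,
    `|(f Na).1.1| <= 1 /\ forall s, size s = Na.1.+1 -> forall n,
      (exists m, sval (f Na).2 s n = sval Na.2 (take Na.1 s) m) /\
      side (nth false s Na.1) (f Na).1.2 (F (sval (f Na).2 s n) (f Na).1.1)}.
  apply: (@choice (nat * T) (X * R * T) (fun Na w =>
    `|w.1.1| <= 1 /\ forall s, size s = Na.1.+1 -> forall n,
      (exists m, sval w.2 s n = sval Na.2 (take Na.1 s) m) /\
      side (nth false s Na.1) w.1.2 (F (sval w.2 s n) w.1.1))) => -[N [a an]] /=.
  have [x [r [p [x1 pn h]]]] := split_leaves N an.
  have an' s n : (n <= a (take N s) (p (nth false s N) n))%N.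
    exact: leq_trans (pn _ n) (an _ _).
  exists (x, r, exist _ (fun s n => a (take N s) (p (nth false s N) n)) an').
  split=> //= s sN n; split; first by exists (p (nth false s N) n).
  have [|h1 h0] := h (take N s) n; first by rewrite size_take sN ltnSn.
  by rewrite /side; case: (nth false s N).
pose a0 : T := exist _ (fun=> id) (fun _ _ => leqnn _).
pose st := fix st N : T := if N is N'.+1 then (f (N', st N')).2 else a0.
pose x k := (f (k, st k)).1.1; pose r k := (f (k, st k)).1.2.
have sideP N : forall k, (k < N)%N -> forall s, size s = N -> forall n,
    side (nth false s k) (r k) (F (sval (st N) s n) (x k)).
  elim: N => // N IH k; rewrite ltnS leq_eqVlt => /predU1P[->|kN] s sN n.
    by have [_ /(_ s sN n)[_]] := fP (N, st N).
  have [_ /(_ s sN n)[[m /= ->] _]] := fP (N, st N).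
  have := IH k kN (take N s) _ m; rewrite nth_take//; apply.
  by rewrite size_take sN ltnSn.
exists x, (fun N k => rademacher N k (fun s => F (sval (st N) s 0%N))); split.
- by move=> k; have [] := fP (k, st k).
- move=> N k kN; rewrite rademacher_eval.
  apply: (@rademacher_ge _ _ _ _ (r k)) => // s sN.
  exact: sideP.
move=> N K z; under eq_bigr do rewrite rademacher_eval.
have := @rademacher_bessel R N K (fun s => F (sval (st N) s 0%N) z).
set S := \sum_(k < K) _.
have := sqr_ge0 (dyadic_avg N (fun s => F (sval (st N) s 0%N) z : R^o) : R).
have : dyadic_avg N (fun s => (F (sval (st N) s 0%N) z : R) ^+ 2 : R^o) <= `|z| ^+ 2.
  apply: dyadic_avg_le => s _; rewrite -real_normK ?num_real//.
  by rewrite ler_pXn2r ?nnegrE//; exact: cF.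
by set p : R := dyadic_avg _ _; set q : R := dyadic_avg _ _; lra.
Qed.

End independent_tree.

(** * Ultralimits of the Rademacher averages *)

Section ultralimits.
Context {R : realType}.

Lemma bounded_ultralimit (T : Type) (U : set_system T) (u : T -> R) (C : R) :
  UltraFilter U -> (forall t, `|u t| <= C) -> exists l : R, u @ U --> l.
Proof.
move=> UU uC.
have uU : UltraFilter (u @ U).
  split=> [|G PG UG]; first exact: fmap_proper_filter.
  apply/seteqP; split=> // A GA.
  have [//|UA] := in_ultra_setVsetC (u @^-1` A) UU.
  by have /filter_ex[v []] : G (A `&` ~` A) by apply: filterI => //; exact: UG.
have : compact `[- C, C] by exact: segment_compact.
rewrite compact_ultra => /(_ _ uU)[].
  by apply: nearW => t /=; rewrite in_itv/= -ler_norml.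
by move=> l [_ ul]; exists l.
Qed.

(** The ultralimits [v k] of [y N k] in [N] inherit Bessel's inequality, so the squares of [v k z]
    are summable and tend to 0, while [v k (x k)] stays at least [c]. *)
Lemma josefson_nissenzweig_of_rademacher (X : normedModType R) (c : R)
    (x : nat -> X) (y : nat -> nat -> dual X) : 0 < c ->
  (forall k, `|x k| <= 1) -> (forall N k, (k < N)%N -> c <= y N k (x k)) ->
  (forall N K z, \sum_(k < K) (y N k z : R) ^+ 2 <= `|z| ^+ 2) ->
  exists y, @josefson_nissenzweig_seq R X y.
Proof.
move=> c0 x1 yx bessel.
have [U [UU sU]] := ultraFilterLemma (eventually_filter : ProperFilter \oo).
have yz N k z : `|y N k z| <= `|z|.
  rewrite -(@ler_pXn2r _ 2)// ?nnegrE// real_normK ?num_real//.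
  apply: le_trans (bessel N k.+1 z); rewrite big_ord_recr /= lerDr.
  by apply: sumr_ge0 => i _; exact: sqr_ge0.
have [L LP] : {L : nat * X -> R &
    forall kz, (y N kz.1 kz.2 : R) @[N --> U] --> L kz}.
  apply: (@choice _ _ (fun kz l => (y N kz.1 kz.2 : R) @[N --> U] --> l)) => -[k z].
  by apply: (bounded_ultralimit UU (C := `|z|)) => N; exact: yz.
have Llin k (a : R) z w : L (k, a *: z + w) = a * L (k, z) + L (k, w).
  apply: (@cvg_unique R _ _ _ _ _ (LP (k, a *: z + w))) => //=.
  have -> : (fun N => y N k (a *: z + w) : R) =
            (fun N => a * (y N k z : R) + (y N k w : R)).
    by apply/funext => N; rewrite linearP.
  by apply: cvgD; [apply: cvgMl_tmp; exact: LP (k, z)|exact: LP (k, w)].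
have Lle k z : `|L (k, z)| <= `|z|.
  apply: (@cvgr_to_le _ U _ R (fun N => `|y N k z : R|)).
    by apply: cvg_norm; exact: LP (k, z).
  by apply: nearW => N; exact: yz.
have [v vP] : {v : nat -> dual X & forall k z, v k z = L (k, z)}.
  apply: (@choice nat (dual X) (fun k phi => forall z, phi z = L (k, z))) => k.
  apply: (@dual_of_bounded _ _ (fun z => L (k, z)) 1) => [a z w|z].
    exact: Llin.
  by rewrite mul1r.
have v_bessel K z : \sum_(k < K) (v k z : R) ^+ 2 <= `|z| ^+ 2.
  apply: (@cvgr_to_le _ U _ R (fun N => \sum_(k < K) (y N k z : R) ^+ 2)).
    elim: K => [|K IH].
      by rewrite big_ord0; under eq_fun do rewrite big_ord0; exact: cvg_cst.
    rewrite big_ord_recr; under eq_fun do rewrite big_ord_recr.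
    apply: cvgD => //=.
    apply: (@cvg_comp _ _ _ _ (fun t : R => t ^+ 2) U (nbhs (L (K, z)))).
      exact: LP (K, z).
    by rewrite vP; exact: exprn_continuous.
  by apply: nearW => N; exact: bessel.
exists v; split.
- exists 1 => k; apply: dual_norm_le => // z z1.
  by rewrite vP (le_trans (Lle k z)).
- exists c => // k; have vc : c <= v k (x k).
    rewrite vP; apply: (cvgr_to_ge (LP (k, x k))).
    by apply: sU; exists k.+1 => // N /=; exact: yx.
  apply: (le_trans vc); rewrite (le_trans (ler_norm _))//.
  by rewrite (le_trans (dual_le_norm _ _))// ler_piMr.
move=> z.
have sq0 : (v k z : R) ^+ 2 @[k --> \oo] --> (0 : R).
  apply: cvg_series_cvg_0; apply: nondecreasing_is_cvgn.
    apply/nondecreasing_seqP => n; rewrite /series/= big_nat_recr//= lerDl.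
    exact: sqr_ge0.
  by exists (`|z| ^+ 2) => _ [n _ <-]; rewrite /series/= big_mkord.
apply/cvgrPdist_lt => e /= e0; move/cvgrPdist_lt: sq0 => /(_ (e ^+ 2)).
rewrite exprn_gt0// => /(_ isT); apply: filterS => k; rewrite !sub0r !normrN.
by rewrite ger0_norm ?sqr_ge0// -real_normK ?num_real// ltr_pXn2r ?nnegrE// ltW.
Qed.

End ultralimits.

(** * The Josefson-Nissenzweig theorem *)

Section josefson_nissenzweig.
Context {R : realType} {X : normedModType R}.

Theorem josefson_nissenzweig : ~ finite_dimensional [set: X] ->
  exists y, @josefson_nissenzweig_seq R X y.
Proof.
move=> infX; apply: contrapT => njn.
have [phi [phi1 phiP]] := spread_sequence infX.
have cphi : contractive phi by apply: contractiveP => n; rewrite phi1.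
(* It suffices that [phi] is weak* null; a subsequence with values at least [e] at [x] is refined to
   a stable far block [G]. *)
have nofreq (x : X) (e : R) : 0 < e -> ~ frequently (fun n => e <= phi n x).
  move=> e0 /frequently_subseq[sigma sP].
  pose F := phi \o sigma.
  have Fphi : far_block F phi by apply: far_block_subseq => n; have [] := sP n.
  have cF : contractive F := far_block_contractive Fphi cphi.
  have [G [GF stG]] := stable_far_block cF.
  have cG : contractive G := far_block_contractive GF cF.
  have := oscillation_ge0 cG; rewrite le_eqVlt => /predU1P[osc0|osc_gt0]; last first.
    have [z [y [z1 yz yb]]] := rademacher_functionals cG stG osc_gt0.
    apply: njn; apply: (josefson_nissenzweig_of_rademacher _ z1 yz yb).
    by rewrite divr_gt0.
  have [|//|cauchyG] := weak_star_cauchy_dichotomy cG.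
    by move=> z; exact: weak_star_cvg_of_oscillation0.
  have x0 : 0 < 4 * (`|x| + 1) by rewrite mulr_gt0// ltr_wpDl.
  (* Small enough that [2 * eta] times the norm of [x] stays below [e], against [e <= G N x]. *)
  pose eta := e / (4 * (`|x| + 1)).
  have eta0 : 0 < eta by rewrite divr_gt0.
  have [N NG] := cauchyG eta eta0.
  have Gphi : far_block G phi := far_block_trans GF Fphi.
  have hullG : midhull phi 0 (G N).
    by apply: (midhull_le (leq0n N)); exact: Gphi.
  (* [z] half-norms [G N] and is killed by all late [phi n], hence by late [G n]; the Cauchy bound
     then makes the norm of [G N] at most [2 * eta]. *)
  have [z [z1 Gz [M _ Mz]]] := phiP _ hullG.
  have GMz n : (M <= n)%N -> G n z = 0.
    move=> Mn; have hn := Gphi n.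
    have le0 : G n z <= 0.
      apply: (hn _ (@midconvex_dual_le _ _ z 0)) => i ni.
      by rewrite /mkset Mz//=; exact: leq_trans ni.
    have ge0 : 0 <= G n z.
      apply: (hn _ (@midconvex_dual_ge _ _ z 0)) => i ni.
      by rewrite /mkset Mz//=; exact: leq_trans ni.
    by apply/eqP; rewrite eq_le le0 ge0.
  have GNz : G N z <= eta.
    pose m := maxn N M.
    have -> : G N z = (G N - G m) z.
      by rewrite dual_add dual_opp [G m z]GMz ?leq_maxr// subr0.
    rewrite (le_trans (ler_norm _))// (le_trans (dual_le_norm _ _))//.
    rewrite (le_trans _ (NG m (leq_maxl _ _)))// ler_piMr//.
  have eG : e <= G N x.
    apply: (GF N _ (@midconvex_dual_ge _ _ x e)) => i _.
    by have [] := sP i.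
  have : e <= 2 * eta * `|x|.
    apply: (le_trans eG); rewrite (le_trans (ler_norm _))//.
    rewrite (le_trans (dual_le_norm _ _))// ler_wpM2r// (le_trans Gz)//.
    by rewrite ler_pM2l.
  have -> : 2 * eta * `|x| = e * (`|x| / (2 * (`|x| + 1))).
    by rewrite /eta; field; rewrite gt_eqF// ltr_wpDl.
  apply/negP; rewrite -ltNge gtr_pMr// ltr_pdivrMr ?mulr_gt0 ?ltr_wpDl//.
  by have := normr_ge0 x; lra.
apply: njn; exists phi; split.
- by exists 1 => n; rewrite phi1.
- by exists 1 => // n; rewrite phi1.
move=> x; apply/cvgrPdist_lt => e /= e0.
have := not_frequently (nofreq x e e0); have := not_frequently (nofreq (- x) e e0).
apply: filterS2 => n; rewrite linearN sub0r normrN => /negP + /negP.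
by rewrite -!ltNge ltr_norml => h1 h2; rewrite h2 andbT ltrNl.
Qed.

End josefson_nissenzweig.

(** * A hierarchy of disjoint bumps *)

Section digits.

(** Level [n] cuts the unit interval into [grid n] equal cells, each split into [2 ^ n.+2] cells of
    level [n.+1]. *)
Fixpoint grid n : nat := if n is n'.+1 then (grid n' * 2 ^ n'.+2)%N else 1%N.

(* All the digits of [j < grid n] in the mixed radices [2 ^ 2], [2 ^ 3], ... are
   nonzero; the least significant digit has the largest radix. *)
Fixpoint full (n j : nat) : bool :=
  if n is n'.+1 then full n' (j %/ 2 ^ n'.+2)%N && (j %% 2 ^ n'.+2 != 0)%N else true.

(** The leftmost children of full cells: these cells of level [n.+1] are removed from the
    Cantor-like set and carry the bumps of level [n]. *)
Definition first_zero (n j : nat) : bool :=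
  full n (j %/ 2 ^ n.+2)%N && (j %% 2 ^ n.+2 == 0)%N.

Lemma gridS n : grid n.+1 = (grid n * 2 ^ n.+2)%N.
Proof. by []. Qed.

Lemma grid_gt0 n : (0 < grid n)%N.
Proof. by elim: n => //= n IH; rewrite muln_gt0 IH expn_gt0. Qed.

Lemma grid_gt n : (n < grid n)%N.
Proof.
elim: n => //= n IH; rewrite (leq_ltn_trans IH)// ltn_Pmulr ?grid_gt0//.
by rewrite -[1%N](expn0 2) ltn_exp2l.
Qed.

Fixpoint ratio n d : nat :=
  if d is d'.+1 then (ratio n d' * 2 ^ (n + d').+2)%N else 1%N.

Lemma gridD n d : grid (n + d) = (grid n * ratio n d)%N.
Proof. by elim: d => [|d IH]; rewrite ?addn0 ?muln1// addnS/= IH mulnA. Qed.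

Lemma ratio_gt0 n d : (0 < ratio n d)%N.
Proof. by elim: d => //= d IH; rewrite muln_gt0 IH expn_gt0. Qed.

Lemma full_div n d j : full (n + d) j -> full n (j %/ ratio n d)%N.
Proof.
elim: d j => [|d IH] j; first by rewrite addn0 divn1.
by rewrite addnS /= => /andP[/IH + _]; rewrite -divnMA mulnC.
Qed.

Lemma first_zero_not_full n j : first_zero n j -> ~~ full n.+1 j.
Proof. by rewrite /first_zero /= => /andP[_ ->]; rewrite andbF. Qed.

Lemma sum_grid (K D : nat) (F : nat -> nat) :
  (\sum_(j < K * D) F j = \sum_(q < K) \sum_(r < D) F (q * D + r))%N.
Proof.
elim: K => [|K IH]; first by rewrite !big_ord0.
by rewrite big_ord_recr /= -IH mulSnr big_split_ord.
Qed.

Lemma sum_full n : (\sum_(j < grid n.+1) full n.+1 j =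
  (\sum_(j < grid n) full n j) * (2 ^ n.+2).-1)%N.
Proof.
rewrite /= (sum_grid _ _
  (fun j => full n (j %/ 2 ^ n.+2)%N && (j %% 2 ^ n.+2 != 0)%N)).
rewrite big_distrl; apply: eq_bigr => q _ /=.
have D0 : (0 < 2 ^ n.+2)%N by rewrite expn_gt0.
under eq_bigr => r _ do
  rewrite divnMDl// (divn_small (ltn_ord r)) addn0 modnMDl (modn_small (ltn_ord r)).
case: (full n q); last by rewrite mul0n big1.
rewrite mul1n -(prednK D0) big_ord_recl /= add0n.
by rewrite (eq_bigr (fun=> 1%N))// sum1_card card_ord.
Qed.

(** Passing from [n] to [n.+1] loses at most the proportion [2^-1 ^+ n.+2] of all cells, which is
    exactly the decrease of the bound; the losses total at most one half. *)
Lemma sum_full_ge (R : realType) n :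
  (grid n)%:R * (2^-1 + 2^-1 ^+ n.+1) <= (\sum_(j < grid n) full n j)%:R :> R.
Proof.
elim: n => [|n IH]; first by rewrite big_ord1 /= expr1 mul1r; lra.
rewrite sum_full gridS [X in X * _]natrM [leRHS]natrM -subn1 natrB ?expn_gt0// natrX.
have h : (2 : R) ^+ n.+2 * 2^-1 ^+ n.+1 = 2.
  by rewrite exprS -mulrA -exprMn mulfV ?pnatr_eq0// expr1n mulr1.
have [p0 p1] : 0 < (2^-1 : R) ^+ n.+1 /\ (2^-1 : R) ^+ n.+1 <= 2^-1.
  split; first by rewrite exprn_gt0// invr_gt0.
  by rewrite exprS ger_pMr ?invr_gt0// exprn_ile1// ?invr_ge0// invf_le1// ler1n.
rewrite [2^-1 ^+ n.+2]exprS; move: h p0 p1 IH.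
have D1 : (1 : R) <= 2 ^+ n.+2 by rewrite exprn_ege1// ler1n.
have : (0 : R) < (grid n)%:R by rewrite ltr0n grid_gt0.
move: ((grid n)%:R : R) ((\sum_(j < grid n) full n j)%:R : R) D1 => K S.
move: (2 ^+ n.+2 : R) (2^-1 ^+ n.+1 : R) => D p D1 K0 h p0 p1 IH.
have : K * (2^-1 + p) * (D - 1) <= S * (D - 1) by rewrite ler_wpM2r// subr_ge0.
apply: le_trans; rewrite -!mulrA ler_pM2l//.
have -> : (2^-1 + p) * (D - 1) = D * 2^-1 + D * p - 2^-1 - p by ring.
by rewrite mulrDr (mulrCA D) h; lra.
Qed.

End digits.

(** * Bumps on the removed cells *)

Section bumps.
Context {R : realType}.

(** Tents of height 1, one on each removed cell, with peak at its centre; the maximum with 0 cuts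
    them off outside. *)
Definition bump_fun n (t : R) : R :=
  \big[Num.max/0]_(j < grid n.+1 | first_zero n j)
    (1 - `|2 * (grid n.+1)%:R * t - (2 * j%:R + 1)|).

Lemma bump_fun_ge0 n t : 0 <= bump_fun n t.
Proof. by apply: bigmax_ge_id. Qed.

Lemma bump_fun_le1 n t : bump_fun n t <= 1.
Proof. by apply: bigmax_le => // j _; rewrite gerBl. Qed.

Lemma bump_fun_neq0 n t : bump_fun n t != 0 -> exists j,
  [/\ first_zero n j, j%:R < (grid n.+1)%:R * t & (grid n.+1)%:R * t < j.+1%:R].
Proof.
move=> h; apply: contrapT => nj; move/negP: h; apply.
rewrite eq_le bump_fun_ge0 andbT; apply: bigmax_le => // j fj.
rewrite leNgt subr_gt0; apply/negP; rewrite ltr_norml => /andP[lo hi].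
apply: nj; exists (j : nat); split=> //.
  by move: lo hi; rewrite -mulrA; set u := _ * t; lra.
by move: lo hi; rewrite -mulrA -natr1; set u := _ * t; lra.
Qed.

Lemma bump_fun_center n j : (j < grid n.+1)%N -> first_zero n j ->
  bump_fun n ((2 * j%:R + 1) / (2 * (grid n.+1)%:R)) = 1.
Proof.
move=> jn fj; apply/eqP; rewrite eq_le bump_fun_le1/=.
apply: (bigmax_sup (Ordinal jn)) => //.
rewrite mulrC divfK ?subrr ?normr0 ?subr0//.
by rewrite mulf_neq0 ?pnatr_eq0// -lt0n (grid_gt0 n.+1).
Qed.

(** For [n <= m.+1] the point is an endpoint of cells of level [m.+1]; otherwise a removed cell
    around it would be an ancestor of the full cell [j], hence full itself. *)
Lemma bump_fun_grid n j m : full n j -> bump_fun m (j%:R / (grid n)%:R) = 0.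
Proof.
move=> fj; apply: contrapT => /eqP /bump_fun_neq0[i [fi lo hi]].
have n0 : (0 : R) < (grid n)%:R by rewrite ltr0n grid_gt0.
have [nm|mn] := leqP n m.+1.
  move: lo hi; rewrite -(subnKC nm) gridD natrM mulrAC mulrCA mulfV ?gt_eqF// mulr1.
  by rewrite -natrM !ltr_nat ltnS => h1 h2; lia.
have [d nE] : exists d, n = (m.+1 + d)%N.
  by exists (n - m.+1)%N; rewrite subnKC// ltnW.
move: fj lo hi (grid_gt0 m.+1) (ratio_gt0 m.+1 d); rewrite nE gridD => fj.
have := full_div fj; set r := ratio _ _; set g := grid _ => fjr + + g0 r0.
have -> : g%:R * (j%:R / (g * r)%:R) = j%:R / r%:R :> R.
  by rewrite natrM; field; rewrite !pnatr_eq0 -!lt0n g0 r0.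
rewrite ltr_pdivlMr ?ltr0n// ltr_pdivrMr ?ltr0n// -!natrM !ltr_nat => lo hi.
have ij : (j %/ r = i)%N.
  by apply/eqP; rewrite eqn_leq -ltnS ltn_divLR// hi leq_divRL// ltnW.
by move: fjr; rewrite ij; apply/negP; exact: first_zero_not_full.
Qed.

(** A cell carrying a bump of level [m] lies in a full cell of each level up to [m], and a full cell
    is never a removed one. *)
Lemma bump_fun_disjoint n m t : bump_fun n t != 0 -> bump_fun m t != 0 -> n = m.
Proof.
wlog nm : n m / (n < m)%N => [h hn hm|].
  have [nm|mn|//] := ltngtP n m; first exact: h.
  by apply/esym; exact: h.
move=> /bump_fun_neq0[j [fj jlo jhi]] /bump_fun_neq0[i [fi ilo ihi]].
have [d mE] : exists d, m = (n.+1 + d)%N by exists (m - n.+1)%N; rewrite subnKC.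
exfalso; move: fi ilo ihi; rewrite /first_zero => /andP[+ _].
rewrite gridS mE gridD => /full_div.
set D := (2 ^ _)%N; set r := ratio _ _; rewrite -divnMA => fi ilo ihi.
have rD0 : (0 < D * r)%N by rewrite muln_gt0 expn_gt0 ratio_gt0.
have g0 : (0 : R) < (grid n.+1)%:R by rewrite ltr0n grid_gt0.
have Eu : (grid n.+1 * r * D)%:R * t = (grid n.+1)%:R * t * (D * r)%:R :> R.
  by rewrite !natrM; ring.
rewrite Eu in ilo ihi.
have rDR : (0 : R) < (D * r)%:R by rewrite ltr0n.
have h1 : (j%:R * (D * r)%:R < i.+1%:R :> R).
  by apply: le_lt_trans ihi; rewrite ler_pM2r// ltW.
have h2 : (i%:R < j.+1%:R * (D * r)%:R :> R).
  by apply: (lt_trans ilo); rewrite ltr_pM2r.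
move: h1 h2; rewrite -!natrM !ltr_nat ltnS => h1 h2.
have ij : (i %/ (D * r) = j)%N.
  by apply/eqP; rewrite eqn_leq -ltnS ltn_divLR// h2 leq_divRL.
by move: fi; rewrite ij; apply/negP; exact: first_zero_not_full.
Qed.

Lemma bump_fun_continuous n : continuous (bump_fun n).
Proof.
apply: continuous_big => [|j _ t]; first exact: max_continuous.
apply: cvgB; first exact: cvg_cst.
apply: cvg_norm; apply: cvgB; last exact: cvg_cst.
by apply: cvgMl_tmp.
Qed.

End bumps.

(** * Layered functions *)

Section layered_functions.
Context {R : realType} {X : normedModType R}.
Implicit Types (y : nat -> dual X) (a : nat -> R) (f : unit_interval R -> dual X).

(** The series of the [(a n * bump_fun n) *: y n], put as a condition because at most one term is
    nonzero at each point. *)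
Definition layered y a f := forall t : unit_interval R,
  (forall n, bump_fun n (set_val t) != 0 ->
    f t = (a n * bump_fun n (set_val t)) *: y n) /\
  ((forall n, bump_fun n (set_val t) = 0) -> f t = 0).

Lemma layered_approx y a f x N (e : R) t : layered y a f -> 0 <= e ->
  (forall n, (N <= n)%N -> `|a n * y n x| <= e) ->
  `|(f t x : R) - \sum_(n < N) a n * bump_fun n (set_val t) * y n x| <= e.
Proof.
move=> /(_ t)[ft ft0] e0 small.
have [[n bn]|nb] := pselect (exists n, bump_fun n (set_val t) != 0); last first.
  have b0 n : bump_fun n (set_val t) = 0.
    by apply/eqP; apply: contrapT => /negP bn; apply: nb; exists n.
  rewrite ft0// dual_zero sub0r normrN big1 ?normr0// => i _.
  by rewrite b0 mulr0 mul0r.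
have other m : m != n -> bump_fun m (set_val t) = 0.
  by apply: contra_neq_eq => bm; exact: bump_fun_disjoint bm bn.
rewrite (ft n bn) dual_scale; have [nN|Nn] := ltnP n N.
  rewrite (bigD1 (Ordinal nN))//= big1 ?addr0 ?subrr ?normr0// => i ni.
  by rewrite other ?mulr0 ?mul0r.
rewrite big1 => [|i _]; last first.
  by rewrite other ?mulr0 ?mul0r// ltn_eqF// (leq_trans _ Nn).
rewrite subr0 mulrAC normrM -[leRHS]mulr1 ler_pM ?normr_ge0// ?small//.
by rewrite ger0_norm ?bump_fun_ge0// bump_fun_le1.
Qed.

(** For fixed [x] the numbers [a n * y n x] tend to 0, so continuous finite sums approximate [f t x]
    uniformly in [t]. *)
Lemma layered_weak_star_continuous y a f (A : R) :
  (forall x, (y n x : R) @[n --> \oo] --> (0 : R)) -> (forall n, `|a n| <= A) ->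
  layered y a f -> continuous (f : unit_interval R -> weak_star X).
Proof.
move=> y0 aA lf; apply: continuous_comp_initial => t0.
apply: (proj2 (@pointwise_cvgP _ _ ((@dual_fun R X \o f) @ nbhs t0) (f t0) _)) => x.
suff : (f t x : R) @[t --> (t0 : unit_interval R)] --> (f t0 x : R) by [].
have Ft0 : Filter (nbhs (t0 : unit_interval R)) := nbhs_filter t0.
apply/cvgrPdist_lt => e /= e0.
have A0 : 0 <= A by rewrite (le_trans _ (aA 0%N)).
have [N _ NP] : \forall n \near \oo, `|a n * y n x| <= e / 4.
  have A1 : 0 < e / (4 * (A + 1)) by rewrite divr_gt0// mulr_gt0// ltr_wpDl.
  move/cvgrPdist_lt: (y0 x) => /(_ _ A1); apply: filterS => n.
  rewrite sub0r normrN normrM => /ltW h.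
  rewrite (le_trans (ler_pM (normr_ge0 _) (normr_ge0 _) (aA n) h))//.
  have -> : A * (e / (4 * (A + 1))) = e / 4 * (A / (A + 1)).
    by field; rewrite gt_eqF// ltr_wpDl.
  rewrite ler_piMr//; first by rewrite divr_ge0// ltW.
  by rewrite ler_pdivrMr ?ltr_wpDl// mul1r lerDl.
pose S (s : R) : R := \sum_(n < N) a n * bump_fun n s * y n x.
have cS : continuous S.
  apply: continuous_big => [|n _ s]; first exact: add_continuous.
  by apply: cvgMr_tmp; apply: cvgMl_tmp; exact: (@bump_fun_continuous R n s).
have e4 : 0 < e / 4 by rewrite divr_gt0.
have /cvgrPdist_lt/(_ _ e4) := cS (set_val t0).
have ct0 := @initial_continuous (unit_interval R) R set_val t0.
move=> /ct0; apply: (@filterS _ (nbhs t0) Ft0) => t /=.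
have := @layered_approx y a f x N (e / 4) t lf (ltW e4) NP.
have := @layered_approx y a f x N (e / 4) t0 lf (ltW e4) NP.
rewrite -/(S (set_val t)) -/(S (set_val t0)).
move: (f t x : R) (f t0 x : R) (S (set_val t)) (S (set_val t0)) => u v s s0.
rewrite !ler_norml !ltr_norml => /andP[? ?] /andP[? ?] /andP[? ?].
by apply/andP; split; lra.
Qed.

Lemma tag_in_unit_interval (K : nat) (tau : 'I_K -> R) (i : 'I_K) :
  i%:R / K%:R < tau i < i.+1%:R / K%:R -> unit_interval R (tau i).
Proof.
move=> /andP[lo hi]; have K0 : (0 < K)%N by rewrite (leq_ltn_trans _ (ltn_ord i)).
rewrite /unit_interval/= in_itv/=; apply/andP; split.
  by apply: ltW; apply: le_lt_trans lo; rewrite divr_ge0.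
by apply: ltW; apply: (lt_le_trans hi); rewrite ler_pdivrMr ?ltr0n// mul1r ler_nat.
Qed.

Lemma uniform_partition (K : nat) (tau : 'I_K -> R) : (0 < K)%N ->
  (forall i : 'I_K, i%:R / K%:R < tau i < i.+1%:R / K%:R) ->
  exists (P : tagged_partition R) (tag : 'I_K -> unit_interval R),
    [/\ forall i, set_val (tag i) = tau i, forall d, K%:R^-1 < d -> tp_norm P < d &
    forall f, riemann_sum f P = \sum_(i < K) K%:R^-1 *: f (tag i)].
Proof.
move=> K0 tauP; have KR : (0 : R) < K%:R by rewrite ltr0n.
pose tag i : unit_interval R := SigSub (mem_set (tag_in_unit_interval (tauP i))).
pose pt (i : 'I_K.+1) : R := i%:R / K%:R.
have pt0 : pt ord0 = 0 by rewrite /pt mul0r.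
have pt1 : pt ord_max = 1 by rewrite /pt divff// gt_eqF.
have ptP i : pt (widen_ord (leqnSn _) i) < set_val (tag i) < pt (lift ord0 i).
  exact: tauP.
pose P := TaggedPartition pt0 pt1 ptP.
have len (i : 'I_K) : @tp_length R P i = K%:R^-1.
  by rewrite /tp_length /= /pt /= /bump/= add1n -mulrBl -natrB// subSnn mul1r.
exists P, tag; split=> // [d Kd|f].
  apply: bigmax_lt => [|i _]; first by apply: lt_trans Kd; rewrite invr_gt0.
  by rewrite len.
by apply: eq_bigr => i _; rewrite len.
Qed.

(** On the partition into cells of level [n], two choices of tags give sums differing by
    [a n *: y n] times the proportion of full cells, so by at least [e * c / 2] in norm; closeness
    to [z] within [e * c / 8] forbids this. *)
Lemma layered_not_riemann_integrable y a f (c e : R) : 0 < c ->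
  (forall n, c <= `|y n|) -> layered y a f -> 0 < e ->
  frequently (fun n => e <= `|a n|) -> ~ riemann_integrable f.
Proof.
move=> c0 yc lf e0 fa [z /(_ (e * c / 8))[|d d0 fz]].
  by rewrite divr_gt0// mulr_gt0.
have [n Nn an] := fa (Num.truncn d^-1).+1.
set K := grid n; set D := (2 ^ n.+2)%N.
have K0 : (0 < K)%N := grid_gt0 n.
have KR : (0 : R) < K%:R by rewrite ltr0n.
have D1 : (1 < D)%N by rewrite /D -[1%N](expn0 2) ltn_exp2l.
have DR : (1 : R) < D%:R by rewrite ltr1n.
have Kd : K%:R^-1 < d.
  rewrite invf_plt ?posrE//; apply: (lt_le_trans (truncnS_gt _)).
  by rewrite ler_nat (leq_trans Nn)// ltnW// grid_gt.
have KD : (grid n.+1)%:R = K%:R * D%:R :> R by rewrite gridS natrM.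
(* In a full cell [tau0], the left end of the second child, avoids all bumps, and [tau1], the centre
   of the first child, has [bump_fun n] equal to 1. In the other cells the tags agree and the terms
   cancel. *)
pose tau0 (i : 'I_K) : R := (i * D + 1)%:R / (grid n.+1)%:R.
pose tau1 (i : 'I_K) : R := if full n i
  then (2 * (i * D)%:R + 1) / (2 * (grid n.+1)%:R) else tau0 i.
have tau0P (i : 'I_K) : i%:R / K%:R < tau0 i < i.+1%:R / K%:R.
  rewrite /tau0 KD natrD natrM -natr1; apply/andP; split.
    rewrite ltr_pdivrMr// mulrAC ltr_pdivlMr ?mulr_gt0//; last by lra.
    by rewrite mulrA mulrAC ltr_pM2r//; lra.
  rewrite ltr_pdivlMr// mulrAC ltr_pdivrMr ?mulr_gt0//; last by lra.
  by rewrite mulrA mulrAC ltr_pM2r//; lra.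
have tau1P (i : 'I_K) : i%:R / K%:R < tau1 i < i.+1%:R / K%:R.
  rewrite /tau1; case: ifP => _; last exact: tau0P.
  rewrite KD natrM -natr1; apply/andP; split.
    rewrite ltr_pdivrMr// mulrAC ltr_pdivlMr ?mulr_gt0//; last by lra.
    by move: KR DR; set k := K%:R; set dd := D%:R; nra.
  rewrite ltr_pdivlMr// mulrAC ltr_pdivrMr ?mulr_gt0//; last by lra.
  by move: KR DR; set k := K%:R; set dd := D%:R; nra.
have [P0 [tag0 [tag0E P0n P0S]]] := uniform_partition K0 tau0P.
have [P1 [tag1 [tag1E P1n P1S]]] := uniform_partition K0 tau1P.
have f0 (i : 'I_K) : full n i -> f (tag0 i) = 0.
  move=> fi; have [_] := lf (tag0 i); apply => m; rewrite tag0E.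
  apply: bump_fun_grid.
  by rewrite /= -/D divnMDl ?(ltnW D1)// divn_small// addn0 fi modnMDl modn_small.
have f1 (i : 'I_K) : full n i -> f (tag1 i) = a n *: y n.
  move=> fi; have fz1 : first_zero n (i * D)%N.
    by rewrite /first_zero -/D mulnK ?(ltnW D1)// fi modnMl.
  have b1 : bump_fun n (set_val (tag1 i)) = 1.
    rewrite tag1E /tau1 fi; apply: bump_fun_center => //.
    by rewrite gridS -/D ltn_pmul2r ?(ltnW D1).
  by have [/(_ n)+ _] := lf (tag1 i); rewrite b1 mulr1 oner_neq0; apply.
have tagE (i : 'I_K) : ~~ full n i -> tag0 i = tag1 i.
  by move=> /negPf fi; apply/val_inj; rewrite /= -!set_valE tag0E tag1E /tau1 fi.
have diff : riemann_sum f P1 - riemann_sum f P0 =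
    (K%:R^-1 * (\sum_(j < K) full n j)%:R * a n) *: y n.
  rewrite P0S P1S -sumrB natr_sum mulr_sumr !mulr_suml scaler_suml.
  apply: eq_bigr => i _; rewrite -scalerBr; case: (boolP (full n i)) => fi.
    by rewrite f0// f1// subr0 scalerA mulr1.
  by rewrite tagE// subrr scaler0 mulr0 mul0r scale0r.
have : `|riemann_sum f P1 - riemann_sum f P0| < e * c / 4.
  rewrite (_ : _ - _ = (riemann_sum f P1 - z) - (riemann_sum f P0 - z)); last first.
    by rewrite opprB addrA subrK.
  apply: (le_lt_trans (ler_normB _ _)).
  by have := fz _ (P1n _ Kd); have := fz _ (P0n _ Kd); lra.
rewrite diff normrZ; apply/negP; rewrite -leNgt.
rewrite normrM (_ : e * c / 4 <= _)//.
have half : 2^-1 <= `|K%:R^-1 * (\sum_(j < K) full n j)%:R| :> R.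
  rewrite ger0_norm ?mulr_ge0// ler_pdivlMl//.
  apply: le_trans (sum_full_ge R n); rewrite ler_pM2l// lerDl.
  by rewrite exprn_ge0// invr_ge0.
have : 2^-1 * e * c <= `|K%:R^-1 * (\sum_(j < K) full n j)%:R| * `|a n| * `|y n|.
  by rewrite !ler_pM// ?mulr_ge0// ltW.
apply: le_trans; have : 0 < e * c by rewrite mulr_gt0.
by rewrite -mulrA; lra.
Qed.

End layered_functions.

(** * Spaceability *)

(** If [n] vectors spanned [L], the identity matrix of size [n.+1] would factor through dimension
    [n]. *)
Lemma not_finite_dimensional_biorthogonal (R : realType) (V : lmodType R)
    (L : set V) (u : nat -> V) (phi : nat -> V -> R) :
  (forall i a v w, phi i (a *: v + w) = a * phi i v + phi i w) ->
  (forall i, L (u i)) -> (forall i j, phi i (u j) = (i == j)%:R) ->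
  ~ finite_dimensional L.
Proof.
move=> phiL Lu phiu [n [e [_ eS]]].
have phi0 i : phi i 0 = 0.
  by have := phiL i 1 0 0; rewrite scale1r addr0 mul1r; lra.
have [c cP] := @choice 'I_n.+1 ('I_n -> R)
  (fun i c => u i = \sum_(k < n) c k *: e k) (fun i => eS _ (Lu i)).
pose B := \matrix_(i < n.+1, k < n) c i k.
pose A := \matrix_(k < n, j < n.+1) phi j (e k).
have BA : B *m A = 1%:M.
  apply/matrixP => i j; rewrite !mxE eq_sym -(phiu j i) cP.
  under eq_bigr do rewrite !mxE.
  elim/big_ind2 : _ => [|v a w b -> ->|k _].
  - by rewrite phi0.
  - by have := phiL j 1 v w; rewrite scale1r mul1r.
  - by have := phiL j (c i k) (e k) 0; rewrite addr0 phi0 addr0.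
have := mxrankM_maxr B A; rewrite BA mxrank1 => /leq_trans/(_ (rank_leq_row A)).
by rewrite ltnn.
Qed.

Section spaceability.
Context {R : realType} {X : normedModType R}.
Variables (y : nat -> dual X) (C c : R).
Hypothesis yC : forall n, `|y n| <= C.
Hypothesis c0 : 0 < c.
Hypothesis cy : forall n, c <= `|y n|.
Hypothesis y_null : forall x, (y n x : R) @[n --> \oo] --> (0 : R).

Local Notation E := (ell_infty (unit_interval R) (dual X)).

(** The default 0 where all bumps vanish is harmless: [peak] is 0 there. *)
Let level (t : unit_interval R) : nat :=
  xget 0%N [set n | bump_fun n (set_val t) != 0].

Let levelP n t : bump_fun n (set_val t) != 0 -> level t = n.
Proof.
move=> bn; rewrite /level; case: xgetP => [m _ bm|/(_ n)] //.
exact: bump_fun_disjoint bm bn.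
Qed.

(* Each class [logn 2 n.+1 = i] of levels is infinite, and the coefficients of
   a function of the subspace are constant on it. *)
Let class (n : nat) : nat := logn 2 n.+1.

Let peak (t : unit_interval R) : dual X :=
  bump_fun (level t) (set_val t) *: y (level t).

Let norm_peak t : `|peak t| <= C.
Proof.
rewrite /peak normrZ ger0_norm ?bump_fun_ge0//.
by rewrite (le_trans _ (yC (level t)))// ler_piMl// bump_fun_le1.
Qed.

Let class_frequently i : frequently (fun n => class n = i).
Proof.
move=> N; have h : (0 < 2 ^ i * N.*2.+1)%N by rewrite muln_gt0 expn_gt0.
(* The successor is [2 ^ i] times an odd number, so its 2-adic valuation is [i]. *)
exists (2 ^ i * N.*2.+1).-1.
  rewrite -ltnS prednK// (leq_trans _ (leq_pmull _ _)) ?expn_gt0//.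
  by rewrite ltnS -addnn leq_addl.
rewrite /class prednK// lognM ?expn_gt0// pfactorK// logn_coprime ?addn0//.
by rewrite coprime2n /= odd_double.
Qed.

Let ell_infty_normP (f : E) t : `|f t| <= `|f|.
Proof. by apply: le_sup_norm => //; exact/asboolP/ell_infty_funP. Qed.

Let first_zero_exists n : exists2 j, (j < grid n.+1)%N & first_zero n j.
Proof.
have [q qn fq] : exists2 q, (q < grid n)%N & full n q.
  elim: n => [|n [q qn fq]]; first by exists 0%N.
  have D1 : (1 < 2 ^ n.+2)%N by rewrite -[1%N](expn0 2) ltn_exp2l.
  exists (q * 2 ^ n.+2 + 1)%N.
    rewrite gridS (leq_trans (n := q.+1 * 2 ^ n.+2))//; last first.
      by rewrite leq_mul2r qn orbT.
    by rewrite mulSnr ltn_add2l.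
  by rewrite /= divnMDl ?(ltnW D1)// divn_small// addn0 fq modnMDl modn_small.
exists (q * 2 ^ n.+2)%N; first by rewrite gridS ltn_pmul2r// expn_gt0.
by rewrite /first_zero mulnK ?expn_gt0// fq modnMl.
Qed.

Let bump_fun_attains1 n : exists t : unit_interval R, bump_fun n (set_val t) = 1.
Proof.
have [j jn fj] := first_zero_exists n.
pose s : R := (2 * j%:R + 1) / (2 * (grid n.+1)%:R).
have g0 : (0 : R) < 2 * (grid n.+1)%:R by rewrite mulr_gt0// ltr0n grid_gt0.
have s01 : unit_interval R s.
  rewrite /unit_interval/= in_itv/= divr_ge0 ?(ltW g0)//=.
  rewrite ler_pdivrMr// mul1r.
  have : (j.+1%:R : R) <= (grid n.+1)%:R by rewrite ler_nat.
  by rewrite -natr1; move: (_%:R) => G; lra.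
exists (SigSub (mem_set s01)); exact: bump_fun_center.
Qed.

Let dual_vector n : exists x, [/\ `|x| <= 2 / c & y n x = 1].
Proof.
have [z z1 yz] := dual_half_norming (y n).
have yz0 : c / 2 <= y n z by have := le_trans (cy n) yz; set p : R := y n z; lra.
have p0 : (0 : R) < y n z by apply: lt_le_trans yz0; rewrite divr_gt0.
exists ((y n z)^-1 *: z); split; last first.
  by rewrite linearZ /= -[_ *: _]/(_ * _) mulVf// gt_eqF.
rewrite normrZ gtr0_norm ?invr_gt0// -[leRHS]mulr1 ler_pM ?invr_ge0 ?(ltW p0)//.
by rewrite -[2 / c]invrK invf_div lef_pV2// posrE divr_gt0.
Qed.

Theorem spaceable_of_josefson_nissenzweig :
  spaceable [set f : E | continuous (f : unit_interval R -> weak_star X) /\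
    ~ riemann_integrable f].
Proof.
have [s sP] := choice bump_fun_attains1.
have [v vP] := choice dual_vector.
pose rep i := (2 ^ i).-1.
have class_rep i : class (rep i) = i.
  by rewrite /class /rep prednK ?expn_gt0// pfactorK.
(* Reads off the coefficient at one level of class [i]: the bump is 1 at [s (rep i)], and
   [y (rep i)] is 1 at [v (rep i)]. *)
pose coef i (f : E) : R := f (s (rep i)) (v (rep i)).
have coefD i (a : R) (f h : E) : coef i (a *: f + h) = a * coef i f + coef i h.
  by [].
have coef_le i (f : E) : `|coef i f| <= `|f| * (2 / c).
  rewrite /coef (le_trans (dual_le_norm _ _))// ler_pM//.
  by have [] := vP (rep i).
(* An equation in the bounded functionals [coef i], so that linearity and closedness are direct. *)
pose L : {pred E} := fun f =>
  `[< forall t, f t = coef (class (level t)) f *: peak t >].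
have L_layered (f : E) : L f -> layered y (fun n => coef (class n) f) f.
  move=> /asboolP Lf t; split=> [n bn|b0].
    by rewrite (Lf t) /peak (levelP bn) scalerA.
  by rewrite (Lf t) /peak b0 scale0r scaler0.
exists L; split.
- split=> [|a f h /asboolP Lf /asboolP Lh]; apply/asboolP => t.
    by have -> : coef (class (level t)) 0 = 0 by []; rewrite scale0r.
  by rewrite coefD scalerDl -scalerA -Lf -Lh.
(* For [h] in [L] near [f], the defect of [f] in the equation equals that of [f - h], at most [M]
   times its norm: 1 for the value and [2 / c * C] for coefficient times peak. *)
- move=> f clf; apply/asboolP => t; apply/eqP; rewrite -subr_eq0 -normr_le0.
  apply/ler_addgt0Pr => e e0; rewrite add0r.
  pose M := 1 + 2 / c * C.
  have C0 : 0 <= C := le_trans (normr_ge0 _) (yC 0%N).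
  have M0 : 0 < M by rewrite ltr_wpDr// mulr_ge0// divr_ge0// ltW.
  have [h [/asboolP Lh]] := clf _ (nbhsx_ballx f (e / M) (divr_gt0 e0 M0)).
  rewrite -ball_normE /= => fh.
  rewrite (_ : f t - _ =
    (f - h) t - coef (class (level t)) (f - h) *: peak t); last first.
    have -> : coef (class (level t)) (f - h) =
      coef (class (level t)) f - coef (class (level t)) h by [].
    by rewrite scalerBl -Lh /= opprB addrA subrK.
  rewrite (le_trans (ler_normB _ _))// normrZ.
  apply: (@le_trans _ _ (`|f - h| * M)).
    rewrite /M mulrDr mulr1 lerD ?ell_infty_normP// mulrA.
    by rewrite ler_pM//; exact: coef_le.
  by rewrite -ler_pdivlMr// ltW.
(* The peaks restricted to single classes form a system biorthogonal to [coef]. *)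
- pose u_fun i t : dual X := if class (level t) == i then peak t else 0.
  have u_bounded i : u_fun i \in bounded_pred.
    apply/asboolP/bounded_inP; exists C => t _; rewrite /u_fun.
    by case: ifP => // _; rewrite normr0 (le_trans (normr_ge0 _) (yC 0%N)).
  pose u i : E := EllInfty (u_bounded i).
  have coef_u i j : coef i (u j) = (i == j)%:R.
    rewrite /coef /= /u_fun (levelP (n := rep i)) ?sP ?oner_neq0// class_rep.
    case: eqVneq => [_|_]; last by rewrite dual_zero.
    rewrite /peak (levelP (n := rep i)) ?sP ?oner_neq0// scale1r.
    by have [] := vP (rep i).
  apply: (@not_finite_dimensional_biorthogonal _ _ _ u coef) => // i.
  apply/asboolP => t; rewrite coef_u /= /u_fun.
  by case: eqVneq => _; rewrite ?scale1r ?scale0r.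
move=> f Lf; have [->|f0] := eqVneq f 0; first by right.
left; split.
  apply: (layered_weak_star_continuous y_null _ (L_layered f Lf)) => n.
  exact: coef_le.
have [t ft] : exists t, f t <> 0.
  apply: contrapT => /forallNP f_eq0; move/eqP: f0; apply.
  by apply/val_inj/funext => t; exact: contrapT (f_eq0 t).
(* A nonzero value forces a nonzero coefficient, which recurs at the infinitely many levels of its
   class. *)
have a0 : coef (class (level t)) f != 0.
  by apply/eqP => a0; apply: ft; have /asboolP/(_ t) := Lf; rewrite a0 scale0r.
apply: (layered_not_riemann_integrable c0 cy (L_layered f Lf)
  (e := `|coef (class (level t)) f|)).
  by rewrite normr_gt0.
by move=> N; have [n Nn <-] := class_frequently (class (level t)) N; exists n.
Qed.

End spaceability.

Theorem corollary3p5 (R : realType) (X : completeNormedModType R)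
    (infX : ~ finite_dimensional [set: X]) :
  spaceable [set f : ell_infty (unit_interval R) (dual X) |
    continuous (f : unit_interval R -> weak_star X) /\
    ~ riemann_integrable f].
Proof.
have [y [[C yC] [c c0 cy] y_null]] := josefson_nissenzweig infX.
exact: spaceable_of_josefson_nissenzweig yC c0 cy y_null.
Qed.
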